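(* Let $N\ge 1$ and $p=p_{N+\ell}:=1+\frac{2}{N+\ell}$ with $\ell\in[0,1]$. Let $\beta>0$ and set $\Phi(\tau):=\tau[\log(e+\tau)]^\beta$ for $\tau\ge0$. For any $T>0$, there exists $\gamma=\gamma(N,\beta,T,\ell)>0$ such that, if $f\in\mathcal L$ satisfies $$\sup_{x\in\overline\Omega}\int_{B_\Omega(x,\sigma)}y_N^\ell\,\Phi\big(T^{\frac1{p-1}}f(y)\big)\,dy\le\gamma T^{\frac{N+\ell}2}\left[\log\left(e+\frac{\sqrt T}\sigma\right)\right]^{\beta-\frac{N+\ell}2}\qquad\text{for all }\sigma\in(0,\sqrt T),$$ then problem (P) with $\mu=x_Nf(x)$ possesses a solution $u$ in $Q_T$, with $u$ satisfying $$0\le u(x,t)\le C\,\Phi^{-1}\Big(\big[G(t)\Phi(T^{\frac1{p-1}}f)\big](x)\Big)\qquad\text{for almost all }(x,t)\in Q_T,$$ for some $C>0$.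
   Context: $\Omega:=\mathbb R^{N-1}\times(0,\infty)$ if $N\ge2$ and $\Omega:=(0,\infty)$ if $N=1$; points are written $x=(x',x_N)$. $B(x,r)$ is the open ball in $\mathbb R^N$ and $B_\Omega(x,r):=B(x,r)\cap\overline\Omega$. $Q_T:=\Omega\times(0,T)$. $\mathcal L$ is the set of nonnegative measurable functions on $\Omega$. $\mathcal L(Q_T)$ is the set of nonnegative, measurable, almost everywhere finite functions on $Q_T$. The function $x_Nf(x)$ is identified with the measure $x_Nf(x)\,dx$ on $\overline\Omega$. Kernels: $\Gamma_d(x,t):=(4\pi t)^{-d/2}\exp(-|x|^2/(4t))$ on $\mathbb R^d\times(0,\infty)$. The Dirichlet heat kernel of $\Omega$ is $$G(x,y,t):=\Gamma_N(x-y,t)\left(1-\exp\left(-\frac{x_Ny_N}{t}\right)\right),\qquad x,y\in\overline\Omega,\ t>0,$$ and, for $x,y\in\overline\Omega$, $t>0$, $K(x,y,t):=y_N^{-1}G(x,y,t)$ if $y_N>0$ and $K(x,y,t):=(\partial_{y_N}G)(x,y,t)=\frac{x_N}{t}\Gamma_N(x-y,t)$ if $y_N=0$. $[G(t)g](x):=\int_\Omega G(x,y,t)g(y)\,dy$. Problem (P), for a nonnegative Radon measure $\mu$ on $\overline\Omega$, is $\partial_tu=\Delta u+u^p$ in $\Omega$, $t>0$, with $u=0$ on $\partial\Omega$ and $x_Nu(x,0)=\mu$ on $\overline\Omega$. A function $u\in\mathcal L(Q_T)$ is a solution to (P) in $Q_T$ if $$u(x,t)=\int_{\overline\Omega}K(x,y,t)\,d\mu(y)+\int_0^t\int_\Omega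 G(x,y,t-s)u(y,s)^p\,dy\,ds$$ for almost all $(x,t)\in Q_T$. *)

(* Defs.v *)
From HB Require Import structures.
From mathcomp Require Import all_boot all_order all_algebra.
From mathcomp Require Import all_classical all_reals all_analysis.
From mathcomp Require Import measurable_realfun.
Set Implicit Arguments.
Unset Strict Implicit.
Unset Printing Implicit Defensive.
Import Order.TTheory GRing.Theory Num.Theory.
Import numFieldNormedType.Exports.
Local Open Scope classical_set_scope.
Local Open Scope ring_scope.

(* The integral of the library is a difference of two suprema over simple
   functions and is therefore defined for every function; it only depends on
   the almost-everywhere class of the integrand, even for a non-measurable
   one. *)
Section integral_ae.
Local Open Scope ereal_scope.
Context d (T : measurableType d) (R : realType).
Variable mu : {measure set T -> \bar R}.
Import HBNNSimple.

Let lower (f : T -> \bar R) := ereal_sup [set sintegral mu h |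
  h in [set h : {nnsfun T >-> R} | forall x, (h x)%:E <= f x]].

Let le_lower (f g : T -> \bar R) (N : set T) :
  measurable N -> mu N = 0 -> (forall x, 0 <= g x) ->
  (forall x, ~ N x -> f x <= g x) -> lower f <= lower g.
Proof.
move=> mN N0 g0 fg; apply: ge_ereal_sup => _ [h hf <-].
have mNC : measurable (~` N) by exact: measurableC.
pose h' := mul_nnsfun h (indic_nnsfun R mNC).
have h'E x : h' x = (h x * \1_(~` N) x)%R by [].
apply: ereal_sup_ubound; exists h'.
  move=> x.
  have [Nx|Nx] := pselect (N x).
    by rewrite h'E indicE memNset ?mulr0//; apply.
  by rewrite h'E indicE mem_set// mulr1; apply: le_trans (hf x) (fg x Nx).
rewrite -!integralT_nnsfun; apply: ae_eq_integral => //.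
- by apply/measurable_EFinP; exact: measurable_funPT.
- by apply/measurable_EFinP; exact: measurable_funPT.
exists N; split => // x /= /not_implyP[_ hx].
apply: contrapT => Nx; apply: hx.
by rewrite /mindic indicE mem_set// mulr1.
Qed.

Lemma integral_ae_eq_class (D : set T) (f g : T -> \bar R) :
  f = g %[ae mu in D] -> \int[mu]_(x in D) f x = \int[mu]_(x in D) g x.
Proof.
move=> [N [mN N0 fgN]].
have e x : ~ N x -> (f \_ D) x = (g \_ D) x.
  move=> Nx; rewrite !patchE; case: ifPn => // /set_mem Dx.
  by apply: contrapT => fg; apply: Nx; apply: fgN => /= /(_ Dx).
rewrite /integral; congr (_ - _); apply/eqP; rewrite eq_le; apply/andP; split;
  apply: (le_lower mN N0) => x; rewrite ?funepos_ge0 ?funeneg_ge0//.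
all: by move=> Nx; rewrite !(funeposE, funenegE) e.
Qed.

End integral_ae.

(* Measurability with respect to the mu-completion of the sigma-algebra: for
   mu the Lebesgue measure this is Lebesgue (and not just Borel)
   measurability. *)
Definition complete_measurable_fun d (T : measurableType d) (R : realType)
    (mu : {measure set T -> \bar R}) (D : set T) (f : T -> \bar R) : Prop :=
  exists2 g : T -> \bar R, measurable_fun D g & f = g %[ae mu in D].

(* The product of two sigma-finite measures, under a name of its own: on
   product_measure1 itself the sigma-finite structure that the library infers
   is the one for products of subprobabilities. *)
Section sigma_finite_product.
Local Open Scope ereal_scope.
Context d1 d2 (T1 : measurableType d1) (T2 : measurableType d2) (R : realType).
Variables (m1 : {sigma_finite_measure set T1 -> \bar R})
  (m2 : {sigma_finite_measure set T2 -> \bar R}).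

Definition sigma_finite_product : set (T1 * T2) -> \bar R := m1 \x m2.

HB.instance Definition _ := Measure.on sigma_finite_product.

Let sigma_finite_productT : sigma_finite setT sigma_finite_product.
Proof.
have /sigma_finiteP[F [TF ndF Foo]] := sigma_finiteT m1.
have /sigma_finiteP[G [TG ndG Goo]] := sigma_finiteT m2.
exists (fun n => F n `*` G n).
  rewrite -setXTT TF TG predeqE => -[x y]; split.
    move=> [/= [n _ Fnx] [k _ Gky]]; exists (maxn n k) => //; split.
    - by move: x Fnx; exact/subsetPset/ndF/leq_maxl.
    - by move: y Gky; exact/subsetPset/ndG/leq_maxr.
  by move=> [n _ []/= ? ?]; split; exists n.
move=> k; have [? ?] := Foo k; have [? ?] := Goo k.
split; first exact: measurableX.
rewrite /sigma_finite_product product_measure1E//.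
by rewrite lte_mul_pinfty// ge0_fin_numE.
Qed.

HB.instance Definition _ := Measure_isSigmaFinite.Build _ _ _
  sigma_finite_product sigma_finite_productT.

End sigma_finite_product.

(* Lebesgue measure on R^n: the image of the product measure on R * R^(n-1)
   under the measurable bijection (x, t) |-> x :: t. *)
Section lebesgue_tuple.
Context (R : realType).
Local Notation mR := (measurableTypeR R).

Definition cons_pair n (z : mR * n.-tuple mR) : n.+1.-tuple mR :=
  [the n.+1.-tuple mR of z.1 :: z.2].

Lemma measurable_cons_pair n : measurable_fun setT (@cons_pair n).
Proof. by apply: measurable_cons. Qed.

Definition lebesgue_cons n
    (mu : {sigma_finite_measure set (n.-tuple mR) -> \bar R}) :
    set (n.+1.-tuple mR) -> \bar R :=
  pushforward (sigma_finite_product (@lebesgue_measure R) mu) (@cons_pair n).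

Section instances.
Variables (n : nat) (mu : {sigma_finite_measure set (n.-tuple mR) -> \bar R}).
Local Open Scope ereal_scope.

Let lebesgue_cons0 : lebesgue_cons mu set0 = 0.
Proof. by rewrite /lebesgue_cons /pushforward preimage_set0 measure0. Qed.

Let lebesgue_cons_ge0 A : 0 <= lebesgue_cons mu A.
Proof. by rewrite /lebesgue_cons /pushforward; exact: measure_ge0. Qed.

Let measurable_preimage_cons_pair (A : set (n.+1.-tuple mR)) :
  measurable A -> measurable (@cons_pair n @^-1` A).
Proof.
by move=> mA; rewrite -[X in measurable X]setTI; exact: measurable_cons_pair.
Qed.

Let lebesgue_cons_sigma_additive : semi_sigma_additive (lebesgue_cons mu).
Proof.
move=> F mF tF mUF; rewrite /lebesgue_cons /pushforward preimage_bigcup.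
apply: measure_semi_sigma_additive.
- by move=> k; exact: measurable_preimage_cons_pair.
- apply/trivIsetP => /= i j _ _ ij; rewrite -preimage_setI.
  by move/trivIsetP : tF => /(_ _ _ _ _ ij) ->//; rewrite preimage_set0.
- by rewrite -preimage_bigcup; exact: measurable_preimage_cons_pair.
Qed.

HB.instance Definition _ := isMeasure.Build _ _ _ (lebesgue_cons mu)
  lebesgue_cons0 lebesgue_cons_ge0 lebesgue_cons_sigma_additive.

Let lebesgue_cons_sigma_finite : sigma_finite setT (lebesgue_cons mu).
Proof.
have [F TF Foo] :=
  sigma_finiteT (sigma_finite_product (@lebesgue_measure R) mu).
pose uncons (t : n.+1.-tuple mR) : mR * n.-tuple mR :=
  (thead t, [tuple of behead t]).
have consK : cancel (@cons_pair n) uncons.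
  by move=> [x t]; congr (_, _); apply: val_inj.
have unconsK : cancel uncons (@cons_pair n).
  by move=> t; rewrite [RHS]tuple_eta; apply: val_inj.
have muncons : measurable_fun setT uncons.
  apply/measurable_fun_pairP; split; first exact: measurable_tnth.
  exact: measurable_behead.
exists (fun k => uncons @^-1` F k).
  by rewrite -preimage_bigcup -TF preimage_setT.
move=> k; have [mFk Fkoo] := Foo k; split.
  by rewrite -[X in measurable X]setTI; exact: muncons.
rewrite /lebesgue_cons /pushforward -comp_preimage.
rewrite (_ : _ @^-1` _ = F k)//.
by apply/seteqP; split => z /=; rewrite consK.
Qed.

HB.instance Definition _ := Measure_isSigmaFinite.Build _ _ _
  (lebesgue_cons mu) lebesgue_cons_sigma_finite.

End instances.

Fixpoint lebesgue_tuple n :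
    {sigma_finite_measure set (n.-tuple mR) -> \bar R} :=
  match n with
  | 0 => @dirac _ (0.-tuple mR) [tuple] R
  | n'.+1 => lebesgue_cons (lebesgue_tuple n')
  end.

End lebesgue_tuple.

(* A point x = (x', x_N) of R^N, N >= 1. *)
Notation coord_space R N :=
  ((N.-1).-tuple (measurableTypeR R) * measurableTypeR R)%type.

Section half_space.
Context {R : realType} {N : nat}.
Implicit Types x y : coord_space R N.

Definition lebesgue_space :
    {sigma_finite_measure set (coord_space R N) -> \bar R} :=
  sigma_finite_product (lebesgue_tuple R N.-1) (@lebesgue_measure R).

Definition lebesgue_spacetime :
    {sigma_finite_measure
       set (coord_space R N * measurableTypeR R)%type -> \bar R} :=
  sigma_finite_product lebesgue_space (@lebesgue_measure R).

Definition xN x : R := x.2.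

Definition sub_space x y : coord_space R N :=
  ([tuple ((tnth x.1 i : R) - (tnth y.1 i : R))%R | i < N.-1], xN x - xN y).

Definition enorm x : R :=
  Num.sqrt ((\sum_(i < N.-1) (tnth x.1 i : R) ^+ 2) + xN x ^+ 2).

Definition Omega : set (coord_space R N) := [set x | 0 < xN x].

Definition Omegabar : set (coord_space R N) := [set x | 0 <= xN x].

Definition BOmega x (r : R) : set (coord_space R N) :=
  [set y | enorm (sub_space y x) < r] `&` Omegabar.

Definition QT (T : R) : set (coord_space R N * measurableTypeR R) :=
  [set z | Omega z.1 /\ 0 < (z.2 : R) < T].

Definition Gamma (z : coord_space R N) (t : R) : R :=
  (4 * pi * t) `^ (- (N%:R / 2)) * expR (- (enorm z ^+ 2 / (4 * t))).

Definition G x y (t : R) : R :=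
  Gamma (sub_space x y) t * (1 - expR (- (xN x * xN y / t))).

(* For yN = 0 this is the derivative of G x y t with respect to the last
   coordinate of y. *)
Definition K x y (t : R) : R :=
  if 0 < xN y then (xN y)^-1 * G x y t
  else xN x / t * Gamma (sub_space x y) t.

Local Open Scope ereal_scope.

Definition heat (t : R) (g : coord_space R N -> \bar R) x : \bar R :=
  \int[lebesgue_space]_(y in Omega) ((G x y t)%:E * g y).

(* Functions on Omega or QT are represented by total functions with values in
   [0, +oo] there; their values elsewhere play no role. *)
Definition inL (f : coord_space R N -> \bar R) : Prop :=
  (forall x, Omega x -> 0 <= f x) /\
  complete_measurable_fun lebesgue_space Omega f.

Definition inLQT (T : R)
    (u : coord_space R N * measurableTypeR R -> \bar R) : Prop :=
  [/\ (forall z, QT T z -> 0 <= u z),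
      complete_measurable_fun lebesgue_spacetime (QT T) u &
      {ae lebesgue_spacetime, forall z, QT T z -> u z < +oo}].

Definition is_solution (T p : R)
    (mu : {measure set (coord_space R N) -> \bar R})
    (u : coord_space R N * measurableTypeR R -> \bar R) : Prop :=
  inLQT T u /\
  {ae lebesgue_spacetime, forall z, QT T z ->
    let x := z.1 in let t : R := z.2 in
    u z = \int[mu]_(y in Omegabar) (K x y t)%:E
      + \int[@lebesgue_measure R]_(s in `]0%R, t[)
          \int[lebesgue_space]_(y in Omega)
            ((G x y (t - s))%:E * u (y, s) `^ p)}.

(* The measure x_N f(x) dx; fL is only used to equip it with its structure of
   measure. *)
Definition xN_density f (fL : inL f) : set (coord_space R N) -> \bar R :=
  fun A => \int[lebesgue_space]_(y in A `&` Omega) ((xN y)%:E * f y).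

Section xN_density_measure.
Variables (f : coord_space R N -> \bar R) (fL : inL f).

Let measurable_xN : measurable_fun setT xN.
Proof. exact: measurable_snd. Qed.

Let measurable_Omega : measurable Omega.
Proof.
rewrite (_ : Omega = setT `&` xN @^-1` `]0%R, +oo[%classic).
  exact: measurable_xN.
by apply/seteqP; split => x /=; rewrite in_itv/= andbT// => -[].
Qed.

Let xN_density_borel : exists h : coord_space R N -> \bar R,
  [/\ measurable_fun Omega h, (forall x, Omega x -> 0 <= h x) &
      forall A, xN_density fL A = \int[lebesgue_space]_(y in A `&` Omega) h y].
Proof.
have [f0 [g mg fg]] := fL.
exists (fun y => (xN y)%:E * maxe (g y) 0); split.
- apply: emeasurable_funM; last exact: measurable_maxe.
  by apply/measurable_EFinP; exact: measurable_funTS.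
- by move=> x xO; apply: mule_ge0; [exact: ltW|rewrite le_max lexx orbT].
- move=> A; apply: integral_ae_eq_class.
  apply: filterS fg => x fgx [_ xO].
  by rewrite -fgx// max_l// f0.
Qed.

Let xN_density0 : xN_density fL set0 = 0.
Proof. by rewrite /xN_density set0I integral_set0. Qed.

Let xN_density_ge0 A : 0 <= xN_density fL A.
Proof.
by apply: integral_ge0 => x [_ xO]; apply: mule_ge0; [exact: ltW|exact: fL.1].
Qed.

Let xN_density_sigma_additive : semi_sigma_additive (xN_density fL).
Proof.
have [h [mh h0 fh]] := xN_density_borel.
move=> F mF tF mUF.
rewrite fh setI_bigcupl ge0_integral_bigcup//.
- under eq_fun do under eq_bigr do rewrite fh.
  apply: is_cvg_ereal_nneg_natsum => k _.
  by apply: integral_ge0 => x [_]; exact: h0.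
- by move=> k; exact: measurableI.
- apply: measurable_funS mh => //.
  by apply: bigcup_sub => k _; exact: subIsetr.
- by move=> x [k _ [_]]; exact: h0.
- exact: trivIset_setIr.
Qed.

HB.instance Definition _ := isMeasure.Build _ _ _ (xN_density fL)
  xN_density0 xN_density_ge0 xN_density_sigma_additive.

End xN_density_measure.

End half_space.

Definition Phi {R : realType} (b : R) (tau : \bar R) : \bar R :=
  (tau * lne ((expR 1)%:E + tau) `^ b)%E.

(* The inverse of Phi b on [0, +oo], which Phi b maps bijectively to itself
   when 0 < b, with Phi b +oo = +oo. *)
Definition Phi_inv {R : realType} (b : R) : \bar R -> \bar R :=
  'pinv_(fun=> 0%E) [set tau | (0 <= tau)%E] (Phi b).

(* Main.v *)
Require Import Defs.
From mathcomp Require Import all_boot all_order all_algebra.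
From mathcomp Require Import all_classical all_reals all_analysis.
From mathcomp Require Import measurable_realfun.
From mathcomp Require Import ring lra.
Set Implicit Arguments.
Unset Strict Implicit.
Unset Printing Implicit Defensive.
Import Order.TTheory GRing.Theory Num.Theory.
Import numFieldNormedType.Exports.
Local Open Scope classical_set_scope.
Local Open Scope ring_scope.

(** Write k = (N + l) / 2, so that p = 1 + 1 / k, and c = T^k = T^(1 / (p - 1)).
Let W(t) = G(t) Phi(c f) be the linear evolution of Phi(c f), and let
v = Phi^-1(W), so that W = v [log(e + v)]^b.  The function (4 / c) v is a
supersolution of the integral equation when gamma is small, and a monotone
iteration started at 0 stays below it and converges to a solution.

The bound on W.  For l in [0, 1] the kernel satisfies
G(x, y, t) <= C t^(-l / 2) y_N^l Gamma(x - y, 2 t) ([G_le_weight]): its boundary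
factor 1 - exp(- x_N y_N / t) vanishes fast enough to pay for y_N^l.  A Gaussian is
dominated by the averages of a wider one over balls of radius sqrt t, so by Tonelli
W(t) <= C t^(-k) sup_z of the integral of y_N^l Phi(c f) over the balls
B(z, sqrt t) ([heat_le_ball_sup]).  With r = sqrt (T / t) and L = log(e + r) the
hypothesis then reads W(t) <= C gamma r^(2 k) L^(b - k).

The linear term.  For every v >= 0 one has tau <= v + Phi(tau) / [log(e + v)]^b,
and G(x, ., t) has mass at most 1; integrating with v = Phi^-1(W) gives
G(t) f <= (2 / c) v ([heat_le_of_heat_Phi]).  This is Jensen's inequality up to
the factor 2.

The nonlinear term.  Estimating v^(p - 1) by its supremum is not enough, as that
supremum is of the order of 1 / (t L), which is not integrable at t = 0.  Instead
v^p is compared with W: since v^(p - 1) [log(e + v)]^(-b) is almost increasing in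
v, and v is at most a small multiple of (r^2 / L)^k, one gets
v^p <= small (T / s) L(s)^(-1 - b) W(s) ([critical_profile_estimates]).  By the
semigroup property G(t - s) W(s) = W(t) ([heat_semigroup]), so the Duhamel
integral is at most small W(t) times the integral over (0, t) of
(T / s) L(s)^(-1 - b), which is O(T L(t)^(-b)) ([integral_logscale]).  Finally
W(t) L(t)^(-b) <= C v(t), because log(e + v) <= C L; the power of L lost to the
time integral is the one by which Phi exceeds the identity. *)

(** * Logarithms against powers *)

Section log_inequalities.
Context {R : realType}.
Implicit Types x y q b A v X : R.

Lemma expR1_ge2 : (2 : R) <= expR 1.
Proof. by have := @expR_ge1Dx R 1; lra. Qed.

Lemma ln_expR1D_ge1 y : 0 <= y -> 1 <= ln (expR 1 + y).
Proof.
move=> y0; rewrite -[leLHS]expRK ler_ln ?posrE ?expR_gt0//; first lra.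
by have := expR_gt0 (1:R); lra.
Qed.

Lemma ln_expR1D_gt0 y : 0 <= y -> 0 < ln (expR 1 + y).
Proof. by move=> /ln_expR1D_ge1; apply: lt_le_trans. Qed.

Lemma ler_ln_expR1D x y : 0 <= x -> x <= y ->
  ln (expR 1 + x) <= ln (expR 1 + y).
Proof.
move=> x0 xy; have e0 := expR_gt0 (1:R).
by rewrite ler_ln ?posrE; lra.
Qed.

Lemma ler_powRl q x y : 0 <= q -> 0 <= x -> x <= y -> x `^ q <= y `^ q.
Proof.
by move=> q0 x0 xy; apply: ge0_ler_powR => //; rewrite nnegrE// (le_trans x0).
Qed.

(** A power inside the logarithm costs only a factor: e + A y^q is at most
(e + A) (e + y)^q, and ln (e + y) >= 1 absorbs the additive term ln (e + A). *)
Lemma ln_expR1D_powR_le A q y : 0 <= A -> 0 <= q -> 0 <= y ->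
  ln (expR 1 + A * y `^ q) <= (ln (expR 1 + A) + q) * ln (expR 1 + y).
Proof.
move=> A0 q0 y0; have e0 := @expR1_ge2.
have L1 := ln_expR1D_ge1 y0.
have LA := ln_expR1D_ge1 A0.
have ey1 : 1 <= (expR 1 + y) `^ q.
  by rewrite -[leLHS](powRr0 (expR 1 + y)); apply: ler_powR => //; lra.
apply: (@le_trans _ _ (ln ((expR 1 + A) * (expR 1 + y) `^ q))).
  rewrite ler_ln ?posrE; last 2 first.
  - have ? : 0 <= A * y `^ q by rewrite mulr_ge0 ?powR_ge0.
    by lra.
  - by apply: mulr_gt0; lra.
  rewrite mulrDl lerD//; first by rewrite ler_peMr//; lra.
  apply: ler_wpM2l => //; apply: ler_powRl => //; lra.
rewrite lnM ?posrE; [|lra|lra].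
rewrite ln_powR mulrDl lerD//.
by rewrite ler_peMr//; lra.
Qed.

(** The function v^q [ln (e + v)]^(-b) need not be increasing, but it is so up to a
constant: if X = A v with A >= 1, then ln (e + X) exceeds ln (e + v) at most by the
factor ln (e + A) + 1, which is O(A^(q / b)). *)
Lemma powR_ln_quasimonotone q b : 0 < q -> 0 < b ->
  exists2 C, 0 < C & forall v X, 0 < v -> v <= X ->
    v `^ q * ln (expR 1 + X) `^ b <= C * (X `^ q * ln (expR 1 + v) `^ b).
Proof.
move=> q0 b0; pose th := q / b.
have th0 : 0 < th by exact: divr_gt0.
have e0 := @expR1_ge2.
pose D := (expR 1 + 1) `^ th / th + 1.
have D0 : 0 < D.
  by rewrite ltr_wpDl// divr_ge0 ?powR_ge0// ltW.
exists (D `^ b); first by rewrite powR_gt0.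
move=> v X v0 vX; have X0 : 0 < X by lra.
pose A := X / v; have A1 : 1 <= A by rewrite ler_pdivlMr// mul1r.
have -> : X = A * v `^ 1 by rewrite powRr1 ?ltW// /A divfK// gt_eqF.
have lv := ln_expR1D_ge1 (ltW v0).
have lA : 1 <= ln (expR 1 + A) by apply: ln_expR1D_ge1; lra.
have At1 : 1 <= A `^ th.
  by rewrite -[leLHS](powRr0 A); apply: ler_powR => //; lra.
have DA : ln (expR 1 + A) + 1 <= D * A `^ th.
  rewrite /D mulrDl mul1r lerD//.
  rewrite mulrAC ler_pdivlMr// mulrC -ln_powR.
  apply: (@le_trans _ _ ((expR 1 + A) `^ th)).
    by apply/ltW/ln_sublinear/powR_gt0; lra.
  rewrite -powRM; [|lra|lra].
  apply: ler_powRl; [lra|lra|].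
  rewrite mulrDl mul1r lerD//.
  by rewrite ler_peMr; lra.
have lX : ln (expR 1 + A * v `^ 1) <= D * A `^ th * ln (expR 1 + v).
  apply: (@le_trans _ _ ((ln (expR 1 + A) + 1) * ln (expR 1 + v))).
    by apply: ln_expR1D_powR_le; lra.
  by apply: ler_wpM2r => //; lra.
have lX0 : 0 < ln (expR 1 + A * v `^ 1).
  by apply: ln_expR1D_gt0; rewrite mulr_ge0 ?powR_ge0//; lra.
apply: (@le_trans _ _ (v `^ q * (D * A `^ th * ln (expR 1 + v)) `^ b)).
  apply: ler_wpM2l; first exact: powR_ge0.
  by apply: ler_powRl => //; lra.
have -> : (A * v `^ 1) `^ q = A `^ q * v `^ q.
  by rewrite (powRr1 (ltW v0)) powRM ?(ltW v0)// (le_trans ler01).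
have -> : (D * A `^ th * ln (expR 1 + v)) `^ b =
    D `^ b * A `^ q * ln (expR 1 + v) `^ b.
  rewrite powRM; [|by rewrite mulr_ge0 ?powR_ge0// ltW|lra].
  by rewrite powRM ?powR_ge0 ?(ltW D0)// -powRrM /th divfK// gt_eqF.
by rewrite le_eqVlt; apply/orP; left; apply/eqP; ring.
Qed.

Lemma exists_small_powR (A q : R) : 0 < A -> 0 < q ->
  exists2 d : R, 0 < d <= 1 & A * d `^ q <= 2.
Proof.
move=> A0 q0; pose e : R := Num.min 1 (2 / A).
have e0 : 0 < e by rewrite lt_min ltr01 divr_gt0.
exists (e `^ q^-1).
  have h1 : 1 `^ q^-1 = 1 :> R by rewrite powR1.
  rewrite powR_gt0//= -[leRHS]h1; apply: ler_powRl.
  - by rewrite invr_ge0 ltW.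
  - exact: ltW.
  - by rewrite ge_min lexx.
rewrite -powRrM mulVf ?gt_eqF// powRr1 ?(ltW e0)// mulrC -ler_pdivlMr//.
by rewrite ge_min lexx orbT.
Qed.

End log_inequalities.

(** * The logarithmic time integral *)

Section log_integral.
Context {R : realType}.

(** The logarithm of the hypothesis on f at the radius sqrt s of the parabolic
scaling. *)
Definition logscale (T s : R) : R := ln (expR 1 + Num.sqrt T / Num.sqrt s).

Local Notation mu := (@lebesgue_measure R).

Lemma measurable_invr : measurable_fun [set: R] (@GRing.inv R).
Proof.
(* Inversion is discontinuous at 0, but it is a product of measurable powers. *)
rewrite (_ : GRing.inv = (fun x : R => x * (x ^+ 2) `^ (-1))).
  apply: measurable_funM => //.
  by apply: (measurableT_comp (measurable_powR _)); exact: exprn_measurable.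
apply/funext => x; rewrite powR_inv1 ?sqr_ge0//.
by have [->|x0] := eqVneq x 0; [rewrite invr0 mul0r|field].
Qed.

Let phi (T s : R) : R := Num.sqrt T * s `^ (- 2^-1).

Let phiE (T s : R) : 0 < s -> logscale T s = ln (expR 1 + phi T s).
Proof.
by move=> s0; rewrite /logscale /phi powRN powR12_sqrt// ltW.
Qed.

Let is_derive_powR (s q : R) : 0 < s ->
  is_derive s 1 (fun x : R => x `^ q) (q * s `^ (q - 1)).
Proof.
move=> s0; have si : s \in `]0, +oo[ by rewrite in_itv/= s0.
apply: DeriveDef; first exact: derivable_powR.
by rewrite -derive1E powR_derive1.
Qed.

Let F (T b s : R) : R := (ln (expR 1 + phi T s)) `^ (- b).
Let f (T b s : R) : R := - b * (ln (expR 1 + phi T s)) `^ (- b - 1) *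
  ((expR 1 + phi T s)^-1 * (Num.sqrt T * (- 2^-1 * s `^ (- 2^-1 - 1)))).

Let phi_ge0 T s : 0 <= phi T s.
Proof. by rewrite mulr_ge0 ?sqrtr_ge0// powR_ge0. Qed.

Let is_derive_F T b (s : R) : 0 < s -> is_derive s 1 (F T b) (f T b s).
Proof.
move=> s0.
have lp := ln_expR1D_gt0 (phi_ge0 T s).
have e0 := expR_gt0 (1 : R).
have ep0 : 0 < expR 1 + phi T s by rewrite ltr_wpDr.
have h1 := @is_derive_powR s (- 2^-1) s0.
have h2 : is_derive s 1 (fun x => expR 1 + phi T x)
   (Num.sqrt T * (- 2^-1 * s `^ (- 2^-1 - 1))).
  rewrite -[X in is_derive _ _ _ X]add0r.
  have hZ : is_derive s 1 (phi T) (Num.sqrt T * (- 2^-1 * s `^ (- 2^-1 - 1))).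
    exact: (is_deriveZ (Num.sqrt T) h1).
  exact: (is_deriveD (is_derive_cst (expR 1) s 1) hZ).
have h3 : is_derive s 1 (fun x => ln (expR 1 + phi T x))
   ((expR 1 + phi T s)^-1 * (Num.sqrt T * (- 2^-1 * s `^ (- 2^-1 - 1)))).
  have := @is_derive1_comp R (@ln R) (fun x => expR 1 + phi T x) s _ _ (is_derive1_ln ep0) h2.
  by [].
have := @is_derive1_comp R (fun x : R => x `^ (- b))
  (fun x => ln (expR 1 + phi T x)) s _ _ (@is_derive_powR _ _ lp) h3.
by [].
Qed.

Let is_derive_cont (g : R -> R) (s dg : R) : is_derive s 1 g dg ->
  {for s, continuous g}.
Proof.
by case=> dg' _; apply/differentiable_continuous/derivable1_diffP.
Qed.

Let continuous_f T b (s : R) : 0 < s -> {for s, continuous (f T b)}.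
Proof.
move=> s0.
have lp := ln_expR1D_gt0 (phi_ge0 T s).
have e0 := expR_gt0 (1 : R).
have ep0 : 0 < expR 1 + phi T s by rewrite ltr_wpDr.
have cphi : {for s, continuous (fun x => expR 1 + phi T x)}.
  apply: cvgD; first exact: cvg_cst.
  apply: cvgM; first exact: cvg_cst.
  exact: is_derive_cont (@is_derive_powR s (- 2^-1) s0).
have cln : {for s, continuous (fun x => ln (expR 1 + phi T x))}.
  apply: (@continuous_comp _ _ _ (fun x => expR 1 + phi T x)) => //.
  exact: continuous_ln.
apply: cvgM.
  apply: cvgM; first exact: cvg_cst.
  apply: (@continuous_comp _ _ _ (fun x => ln (expR 1 + phi T x))
     (fun y => y `^ (- b - 1))) => //.
  exact: is_derive_cont (@is_derive_powR _ _ lp).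
apply: cvgM.
  by apply: cvgV => //; rewrite gt_eqF.
apply: cvgM; first exact: cvg_cst.
apply: cvgM; first exact: cvg_cst.
exact: is_derive_cont (@is_derive_powR _ _ s0).
Qed.

Let integral_f T b (a t : R) : 0 < a -> a < t ->
  (\int[mu]_(s in `[a, t]) (f T b s)%:E = (F T b t)%:E - (F T b a)%:E)%E.
Proof.
move=> a0 at'; apply: continuous_FTC2 => //.
- apply: continuous_in_subspaceT => x /set_mem/=; rewrite in_itv/= => /andP[ax _].
  by apply: continuous_f; exact: lt_le_trans ax.
- split.
  + move=> x; rewrite in_itv/= => /andP[ax _].
    by case: (@is_derive_F T b x (lt_trans a0 ax)).
  + by apply: cvg_at_right_filter; exact: is_derive_cont (@is_derive_F T b a a0).
  + by apply: cvg_at_left_filter;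
      exact: is_derive_cont (@is_derive_F T b t (lt_trans a0 at')).
- move=> x; rewrite in_itv/= => /andP[ax _].
  by rewrite derive1E; case: (@is_derive_F T b x (lt_trans a0 ax)).
Qed.

(** The derivative f of L^(-b) controls the integrand because
d/ds ln (e + u) = - u / (2 s (e + u)) for u = sqrt (T / s), where u / (e + u) is
bounded below for s < T. *)
Let f_lb T b (s : R) : 0 < b -> 0 < s -> s < T ->
  (T / s) / (logscale T s * logscale T s `^ b) <=
  (2 * (expR 1 + 1) / b * T) * f T b s.
Proof.
move=> b0 s0 sT; have T0 := lt_trans s0 sT.
rewrite phiE//; set u := phi T s; set L := ln (expR 1 + u).
have u0 : 0 <= u by exact: phi_ge0.
have e0 := expR_gt0 (1 : R).
have L0 : 0 < L by exact: ln_expR1D_gt0.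
have Lb : 0 < L `^ b by rewrite powR_gt0.
have u1 : 1 <= u.
  rewrite /u /phi powRN powR12_sqrt ?(ltW s0)// ler_pdivlMr ?sqrtr_gt0// mul1r.
  by rewrite ler_sqrt// ltW.
have sE : Num.sqrt T * s `^ (- 2^-1 - 1) = u / s.
  rewrite powRD; last by apply/implyP => _; rewrite gt_eqF.
  by rewrite powR_inv1 ?(ltW s0)// mulrA.
have LE : L `^ (- b - 1) = (L * L `^ b)^-1.
  rewrite -opprD powRN powRD; last by apply/implyP => _; rewrite gt_eqF.
  by rewrite powRr1 ?(ltW L0)// mulrC.
have -> : 2 * (expR 1 + 1) / b * T * f T b s =
    T / s / (L * L `^ b) * ((expR 1 + 1) * (u / (expR 1 + u))).
  rewrite /f -/u -/L LE.
  have -> : Num.sqrt T * (- 2^-1 * s `^ (- 2^-1 - 1)) =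
    - 2^-1 * (Num.sqrt T * s `^ (- 2^-1 - 1)) by ring.
  rewrite sE.
  have eu : expR 1 + u != 0 by rewrite gt_eqF// ltr_wpDr.
  by field; rewrite !gt_eqF//= ltr_wpDr.
rewrite ler_peMr//.
  by rewrite !divr_ge0 ?mulr_ge0 ?(ltW L0) ?(ltW Lb) ?(ltW T0) ?(ltW s0).
rewrite mulrA ler_pdivlMr ?mul1r; last by rewrite ltr_wpDr.
by rewrite mulrDl mul1r lerD// ler_peMr// ltW.
Qed.

Lemma measurable_logscale T : measurable_fun setT (logscale T : R -> R).
Proof.
apply: (measurableT_comp (@measurable_ln R)).
apply: measurable_funD => //; apply: measurable_funM => //.
rewrite (_ : (fun x => (Num.sqrt x)^-1) = (fun x => Num.sqrt x `^ (-1))).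
  apply: (measurableT_comp (measurable_powR _)).
  apply: continuous_measurable_fun; exact: sqrt_continuous.
by apply/funext => x; rewrite powR_inv1// sqrtr_ge0.
Qed.

(** The integrand is at most a constant times the derivative of L^(-b), which tends
to 0 at s = 0.  As it is unbounded there, the fundamental theorem of calculus is
applied on [t / (n + 2), t]. *)
Lemma integral_logscale (T b : R) : 0 < b -> exists2 C : R, 0 < C &
  forall t, 0 < t -> t < T ->
  (\int[mu]_(s in `]0%R, t[)
    ((T / s) / (logscale T s * logscale T s `^ b))%:E
  <= (C * T / logscale T t `^ b)%:E)%E.
Proof.
move=> b0; have e0 := expR_gt0 (1 : R).
have C0 : 0 < 2 * (expR 1 + 1) / b by rewrite divr_gt0// mulr_gt0// addr_gt0.
exists (2 * (expR 1 + 1) / b) => //.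
move=> t t0 tT; have T0 := lt_trans t0 tT.
pose g s := ((T / s) / (logscale T s * logscale T s `^ b))%:E.
pose I n : set R := `[t / n.+2%:R, t]%classic.
have Tt r : t / r.+2%:R > 0 :> R by rewrite divr_gt0.
have IE n x : I n x -> 0 < x /\ x <= t.
  by rewrite /I/= in_itv/= => /andP[+ ->]; split => //; exact: lt_le_trans (Tt n) _.
have g0 s : 0 < s -> (0 <= g s)%E.
  move=> s0; rewrite lee_fin.
  have L0 : 0 < logscale T s by rewrite ln_expR1D_gt0// divr_ge0// sqrtr_ge0.
  by rewrite divr_ge0 ?divr_ge0 ?mulr_ge0 ?powR_ge0 ?ltW.
have mg : measurable_fun setT g.
  apply/measurable_EFinP; apply: measurable_funM.
    by apply: measurable_funM => //; exact: measurable_invr.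
  apply: (measurableT_comp measurable_invr).
  apply: measurable_funM; first exact: measurable_logscale.
  by apply: (measurableT_comp (measurable_powR _)); exact: measurable_logscale.
apply: (@le_trans _ _ (\int[mu]_(s in \bigcup_n I n) g s)%E).
  apply: ge0_subset_integral => //.
  - by apply: bigcup_measurable => n _; exact: measurable_itv.
  - exact: measurable_funTS.
  - by move=> x [n _ /IE[x0 _]]; exact: g0.
  - move=> x; rewrite /= in_itv/= => /andP[x0 xt].
    have [n hn] : exists n : nat, t / x < n%:R.
      by exists (Num.truncn (t / x)).+1; rewrite truncnS_gt.
    exists n => //; rewrite /I/= in_itv/= (ltW xt) andbT.
    rewrite ler_pdivrMr// mulrC -ler_pdivrMr//.
    by rewrite (le_trans (ltW hn))// ler_nat; do 2 apply: leqW.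
have cvI : (\int[mu]_(s in I n) g s)%E @[n --> \oo] -->
    (\int[mu]_(s in \bigcup_n I n) g s)%E.
  apply: ge0_nondecreasing_set_cvg_integral => //.
  - move=> m n mn; apply/subsetPset => x; rewrite /I/= !in_itv/= => /andP[h ->].
    rewrite andbT (le_trans _ h)// ler_pM2l// lef_pV2 ?posrE//.
    by rewrite ler_nat !ltnS.
  - by move=> n; exact: measurable_itv.
  - by move=> n; exact: measurable_funTS.
  - by move=> n x /IE[x0 _]; exact: g0.
rewrite -(cvg_lim _ cvI)//; apply: lime_le; first by apply/cvg_ex; eexists; exact: cvI.
apply: nearW => n.
have tn : t / n.+2%:R < t.
  by rewrite ltr_pdivrMr// ltr_pMr// ltr1n.
have mf : measurable_fun (I n) (fun s => (f T b s)%:E).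
  apply/measurable_EFinP.
  apply: (@subspace_continuous_measurable_fun R (I n) (f T b)); first exact: measurable_itv.
  apply: continuous_in_subspaceT => x /set_mem /IE[x0 _].
  exact: continuous_f.
apply: (@le_trans _ _ (\int[mu]_(s in I n)
    ((2 * (expR 1 + 1) / b * T)%:E * (f T b s)%:E))%E).
  apply: ge0_le_integral => //.
  - exact: measurable_itv.
  - by move=> x /IE[x0 _]; exact: g0.
  - exact: measurable_funTS.
  - exact: measurable_funeM.
  - move=> x /IE[x0 xt]; rewrite -EFinM lee_fin; apply: f_lb => //.
    exact: le_lt_trans xt tT.
have lF (s : R) : 0 < s -> F T b s = (logscale T s `^ b)^-1.
  by move=> s0; rewrite phiE// -powRN.
have fge0 x : I n x -> (0 <= (f T b x)%:E)%E.
  move=> Ix; have [x0 xt] := IE n x Ix.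
  have CT0 : 0 < 2 * (expR 1 + 1) / b * T by exact: mulr_gt0.
  rewrite lee_fin -(pmulr_rge0 _ CT0).
  by apply: le_trans (f_lb b0 x0 (le_lt_trans xt tT)); have := g0 _ x0; rewrite lee_fin.
rewrite ge0_integralZl_EFin//; [|exact: measurable_itv|exact/ltW/mulr_gt0].
rewrite /I integral_f// -EFinB -EFinM lee_fin.
apply: ler_wpM2l; first by rewrite mulr_ge0// ltW.
by rewrite -lF// gerBl// lF// invr_ge0 powR_ge0.
Qed.

End log_integral.

(** * The critical profile *)

Section profile.
Context {R : realType}.
Implicit Types r v w d : R.

(** X = (r^2 / L)^k is the size that the hypothesis allows to Phi^-1(W) at the scale
r.  It lies between (r / e)^k and r^(2 k), so its logarithm is comparable with L. *)
Lemma ln_critical_profile_equiv (k : R) : 0 < k -> exists2 C : R, 0 < C &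
  forall r, 1 <= r -> let L := ln (expR 1 + r) in let X := (r ^+ 2 / L) `^ k in
  L <= C * ln (expR 1 + X) /\ ln (expR 1 + X) <= C * L.
Proof.
move=> k0; have e0 := @expR1_ge2 R.
pose C1 : R := ln (expR 1 + expR 1) + k^-1.
pose C2 : R := ln (expR 1 + 1) + (2 * k).
have ki0 : 0 < k^-1 by rewrite invr_gt0.
have C10 : 0 < C1 by rewrite addr_gt0// ln_expR1D_gt0//; lra.
have C20 : 0 < C2 by rewrite addr_gt0// ?ln_expR1D_gt0//; lra.
exists (C1 + C2); first by rewrite addr_gt0.
move=> r r1 L X.
have L1 : 1 <= L by apply: ln_expR1D_ge1; lra.
have Ler : L <= expR 1 * r.
  have : L <= expR 1 - 1 + r.
    have -> : L = ln (1 + (expR 1 + r - 1)) by rewrite /L; congr ln; ring.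
    by apply: le_trans (le_ln1Dx _) _; lra.
  move=> h; apply: (le_trans h).
  have : (expR 1 - 1) * 1 <= (expR 1 - 1) * r by apply: ler_wpM2l; lra.
  lra.
have X0 : 0 <= X by exact: powR_ge0.
have rX : r <= expR 1 * X `^ k^-1.
  rewrite /X -powRrM divff ?gt_eqF// powRr1; last first.
    by apply: divr_ge0; [exact: sqr_ge0|lra].
  rewrite mulrA ler_pdivlMr; last lra.
  rewrite expr2 mulrA mulrC; apply: ler_wpM2r => //; lra.
have Xr : X <= 1 * r `^ (2 * k).
  rewrite mul1r powRrM; apply: ler_powRl; first exact: ltW.
    by apply: divr_ge0; [exact: sqr_ge0|lra].
  rewrite powR_mulrn; last lra.
  by rewrite ler_pdivrMr; [rewrite ler_peMr// sqr_ge0|lra].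
have lX := ln_expR1D_ge1 X0.
split.
  apply: (@le_trans _ _ (C1 * ln (expR 1 + X))).
    apply: le_trans (ln_expR1D_powR_le _ _ X0); [|lra|lra].
    by apply: ler_ln_expR1D => //; lra.
  by apply: ler_wpM2r; lra.
apply: (@le_trans _ _ (C2 * L)); last by apply: ler_wpM2r; lra.
apply: le_trans (ln_expR1D_powR_le _ _ _); [|lra|lra|lra].
exact: ler_ln_expR1D.
Qed.

Lemma ltr_mul_ln_powR (b v w : R) : 0 <= b -> 0 <= v -> v < w ->
  v * ln (expR 1 + v) `^ b < w * ln (expR 1 + w) `^ b.
Proof.
move=> b0 v0 vw.
have lv := ln_expR1D_ge1 v0.
have lw := @ler_ln_expR1D R v w v0 (ltW vw).
apply: (@le_lt_trans _ _ (v * ln (expR 1 + w) `^ b)).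
  by apply: ler_wpM2l => //; apply: ler_powRl => //; lra.
by rewrite ltr_pM2r// powR_gt0; lra.
Qed.

(** Inverting Phi: a bound Phi(v) <= small X L^b yields v <= d X.  Passing
from Phi(X) to Phi(d X) divides the logarithm at most by ln (e + 1 / d) + 1, so the
small constant depends on d but not on X. *)
Lemma le_of_mul_ln_powR_le (b d C L X v : R) :
  0 < b -> 0 < d -> 0 < C -> 1 <= L -> 0 < X -> L <= C * ln (expR 1 + X) ->
  0 <= v ->
  v * ln (expR 1 + v) `^ b <=
    d * X * L `^ b / (C * (ln (expR 1 + d^-1) + 1)) `^ b ->
  v <= d * X.
Proof.
move=> b0 d0 C0 L1 X0 LX v0 hv.
have di0 : 0 <= d^-1 by rewrite invr_ge0 ltW.
set Cd := ln (expR 1 + d^-1) + 1 in hv *.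
have Cd0 : 0 < Cd by rewrite addr_gt0// ln_expR1D_gt0.
have CCd0 : 0 < C * Cd by exact: mulr_gt0.
have dX0 : 0 < d * X by exact: mulr_gt0.
have ldX := ln_expR1D_gt0 (ltW dX0).
rewrite leNgt; apply/negP => vdX.
have := ltr_mul_ln_powR (ltW b0) (ltW dX0) vdX.
rewrite ltNge => /negP; apply; apply: (le_trans hv).
rewrite ler_pdivrMr ?powR_gt0// -[leRHS]mulrA; apply: ler_wpM2l; first exact: ltW.
rewrite -powRM ?(ltW ldX) ?(ltW CCd0)//.
apply: ler_powRl; [exact: ltW|exact: le_trans L1|].
apply: (le_trans LX); rewrite [leRHS]mulrC -[leRHS]mulrA.
apply: ler_wpM2l; first exact: ltW.
have {1}-> : X = d^-1 * (d * X) `^ 1.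
  by rewrite powRr1 ?(ltW dX0)// mulKf// gt_eqF.
by apply: ln_expR1D_powR_le => //; exact: ltW.
Qed.

(** One factor v^q is spent on the small constant d^q, the other one on the almost
monotonicity of v^q [ln (e + v)]^(-b). *)
Lemma powR_double_ln_le (q b : R) : 0 < q -> 0 < b ->
  exists2 C : R, 0 < C & forall d X v, 0 < d -> 0 < v -> v <= d * X -> v <= X ->
    v `^ q * v `^ q * ln (expR 1 + X) `^ b <=
    C * d `^ q * (X `^ q * X `^ q) * ln (expR 1 + v) `^ b.
Proof.
move=> q0 b0; have [C C0 hC] := powR_ln_quasimonotone q0 b0.
exists C => // d X v d0 v0 vdX vX.
have X0 : 0 <= X by exact: le_trans (ltW v0) vX.
have vq : v `^ q <= d `^ q * X `^ q.
  by rewrite -powRM ?(ltW d0)//; apply: ler_powRl => //; exact: ltW.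
apply: (@le_trans _ _ (d `^ q * X `^ q * (v `^ q * ln (expR 1 + X) `^ b))).
  rewrite -[leLHS]mulrA; apply: ler_wpM2r => //.
  by rewrite mulr_ge0 ?powR_ge0.
apply: le_trans (ler_wpM2l _ (hC v X v0 vX)) _; first by rewrite mulr_ge0 ?powR_ge0.
by rewrite le_eqVlt; apply/orP; left; apply/eqP; ring.
Qed.

(** The constant C does not depend on d, which is what makes the Duhamel term small:
eta is chosen after d. *)
Lemma critical_profile_estimates (k b : R) : 0 < k -> 0 < b ->
  exists2 C : R, 0 < C & forall d, 0 < d <= 1 -> exists2 eta : R, 0 < eta &
  forall r v, 1 <= r -> 0 <= v ->
  let L := ln (expR 1 + r) in let w := v * ln (expR 1 + v) `^ b in
  w <= eta * r `^ (2 * k) * L `^ (b - k) ->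
  v `^ (1 + k^-1) <= C * d `^ (k^-1 / 2) * (r ^+ 2 / (L * L `^ b)) * w /\
  w <= C * L `^ b * v.
Proof.
move=> k0 b0; have ki0 : 0 < k^-1 by rewrite invr_gt0.
have [C1 C10 H1] := ln_critical_profile_equiv k0.
pose q := k^-1 / 2; have q0 : 0 < q by rewrite divr_gt0.
have qq : q + q = k^-1 by rewrite /q -splitr.
clearbody q.
have [C3 C30 H3] := powR_double_ln_le q0 b0.
have C1b : 0 < C1 `^ b by exact: powR_gt0.
exists (C1 `^ b * (C3 + 1)); first by rewrite mulr_gt0// addr_gt0.
move=> d /andP[d0 d1].
have Cd0 : 0 < ln (expR 1 + d^-1) + 1.
  by rewrite addr_gt0// ln_expR1D_gt0// invr_ge0 ltW.
exists (d / (C1 * (ln (expR 1 + d^-1) + 1)) `^ b).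
  by rewrite divr_gt0// powR_gt0// mulr_gt0.
move=> r v r1 v0 L w; have r0 : 0 <= r by exact: le_trans r1.
have [LX XL] := H1 r r1; rewrite -/L in LX XL.
have L1 : 1 <= L by exact: ln_expR1D_ge1.
clearbody L; have L0 : 0 < L by exact: lt_le_trans L1.
have r20 : 0 <= r ^+ 2 / L by rewrite divr_ge0 ?sqr_ge0// ltW.
have XL1 : ((r ^+ 2 / L) `^ k) `^ k^-1 = r ^+ 2 / L.
  by rewrite -powRrM divff ?gt_eqF// powRr1.
have rX : r `^ (2 * k) = (r ^+ 2 / L) `^ k * L `^ k.
  by rewrite -powRM ?(ltW L0)// divfK ?gt_eqF// powRrM powR_mulrn.
have X0 : 0 < (r ^+ 2 / L) `^ k.
  by rewrite powR_gt0// divr_gt0// exprn_gt0// (lt_le_trans _ r1).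
move: (_ `^ k) X0 LX XL XL1 rX => X X0 LX XL XL1 rX.
have Lb : L `^ b = L `^ k * L `^ (b - k).
  by rewrite -powRD ?subrKC//; apply/implyP => _; rewrite gt_eqF.
rewrite (_ : _ * L `^ (b - k) =
    d * X * L `^ b / (C1 * (ln (expR 1 + d^-1) + 1)) `^ b); last first.
  by rewrite rX Lb; ring.
move=> hw; have vdX := le_of_mul_ln_powR_le b0 d0 C10 L1 X0 LX v0 hw.
have vX : v <= X by apply: (le_trans vdX); rewrite ler_piMl// ltW.
have Lb0 : 0 < L `^ b by exact: powR_gt0.
have lX := ln_expR1D_gt0 (ltW X0).
split; last first.
  rewrite /w mulrC; apply: ler_wpM2r => //.
  apply: (@le_trans _ _ (C1 `^ b * L `^ b)); last first.
    rewrite -mulrA; apply: ler_wpM2l; first exact: ltW.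
    by rewrite ler_peMl ?(ltW Lb0)// lerDr ltW.
  rewrite -powRM ?(ltW C10) ?(ltW L0)//.
  apply: ler_powRl; [exact: ltW|exact/ltW/ln_expR1D_gt0|].
  by apply: le_trans XL; exact: ler_ln_expR1D.
have := v0; rewrite le_eqVlt => /predU1P[v00|vp].
  by rewrite /w -v00 mul0r mulr0 powR0// gt_eqF// addr_gt0.
have LXb : L `^ b <= C1 `^ b * ln (expR 1 + X) `^ b.
  by rewrite -powRM ?(ltW C10) ?(ltW lX)//; apply: ler_powRl => //; exact: ltW.
have h3 := H3 d X v d0 vp vdX vX.
rewrite -powRD in h3; last by apply/implyP => _; rewrite gt_eqF.
rewrite -[X `^ q * _]powRD in h3; last by apply/implyP => _; rewrite gt_eqF.
rewrite qq XL1 in h3.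
rewrite powRD; last by apply/implyP => _; rewrite gt_eqF.
rewrite powRr1// (_ : _ * w = v * (C1 `^ b * ((C3 + 1) * d `^ (k^-1 / 2) *
    (r ^+ 2 / L) * ln (expR 1 + v) `^ b) / L `^ b)); last first.
  by rewrite /w invfM; ring.
apply: ler_wpM2l => //; rewrite ler_pdivlMr//.
apply: le_trans (ler_wpM2l (powR_ge0 _ _) LXb) _.
rewrite mulrCA; apply: ler_wpM2l; first exact: ltW.
apply: (le_trans h3).
have -> : k^-1 / 2 = q by rewrite -qq; field.
do 3 (apply: ler_wpM2r; first by rewrite ?powR_ge0).
by rewrite lerDl.
Qed.

End profile.

(** * The function Phi and its inverse *)

Section Phi.
Context {R : realType} (b : R).
Hypothesis b0 : 0 < b.
Local Open Scope ereal_scope.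

Lemma Phi_EFin (v : R) : (0 <= v)%R ->
  Phi b v%:E = (v * ln (expR 1 + v) `^ b)%:E.
Proof.
move=> v0; rewrite /Phi -EFinD lne_EFin ?poweR_EFin//.
by rewrite ltr_wpDr// expR_gt0.
Qed.

Lemma Phiy : Phi b +oo = +oo.
Proof. by rewrite /Phi addey// poweRyr ?gt_eqF// mulyy. Qed.

Lemma Phi_ge0 x : 0 <= x -> 0 <= Phi b x.
Proof. by move=> x0; rewrite mule_ge0// poweR_ge0. Qed.

Lemma measurable_Phi_comp d (T : measurableType d) (h : T -> \bar R) :
  measurable_fun setT h -> (forall x, 0 <= h x) ->
  measurable_fun setT (fun x => Phi b (h x)).
Proof.
move=> mh h0; apply: emeasurable_funM => //.
apply: (measurableT_comp (measurable_poweR _)).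
rewrite (_ : (fun _ => _) = (fun x => if h x == +oo then +oo
    else (ln (expR 1 + fine (h x)))%:E)).
  apply: measurable_fun_ifT => //.
    by apply: measurable_fun_eqe.
  apply/measurable_EFinP; apply: (measurableT_comp (@measurable_ln R)).
  by apply: measurable_funD => //; exact: (measurableT_comp (@fine_measurable _ _ measurableT)).
apply/funext => x; have := h0 x; case: (h x) => [r r0|_|//].
  by rewrite -EFinD lne_EFin// ltr_wpDr// expR_gt0.
by rewrite addey.
Qed.

(** Phi is onto [0, +oo] by the intermediate value theorem, so the partial inverse
[Phi_inv] is a right inverse; it is finite at w because Phi(+oo) = +oo. *)
Lemma Phi_invE (w : R) : (0 <= w)%R -> exists v : R,
  [/\ (0 <= v)%R, Phi_inv b w%:E = v%:E & (w = v * ln (expR 1 + v) `^ b)%R].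
Proof.
move=> w0.
have [v0 v00 Hv0] : exists2 v : R, (0 <= v)%R & Phi b v%:E = w%:E.
  pose f (v : R) := (v * ln (expR 1 + v) `^ b)%R.
  have e0 := expR_gt0 (1 : R).
  have lw := @ln_expR1D_ge1 R w w0.
  have [||c] := @IVT R f 0%R w w w0.
  - apply: continuous_in_subspaceT => v /set_mem/=; rewrite in_itv/= => /andP[v0 _].
    have lv : (0 < ln (expR 1 + v))%R by exact: ln_expR1D_gt0.
    apply: cvgM; first exact: cvg_id.
    apply: (@continuous_comp _ _ _ (fun v => ln (expR 1 + v)) (fun y : R => y `^ b)%R).
      apply: (@continuous_comp _ _ _ (fun v : R => expR 1 + v)%R (@ln R)).
        by apply: cvgD; [exact: cvg_cst|exact: cvg_id].
      by apply: continuous_ln; rewrite ltr_wpDr.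
    by apply/differentiable_continuous/derivable1_diffP/derivable_powR; rewrite in_itv/= lv.
  - rewrite /f mul0r ge_min w0/= le_max; apply/orP; right.
    by rewrite ler_peMr// -[leLHS](powRr0 (ln (expR 1 + w))); apply: ler_powR => //; exact: ltW.
  - rewrite in_itv/= => /andP[c0 _] fc; exists c => //.
    by rewrite Phi_EFin// -fc.
have img : w%:E \in [set Phi b x | x in [set tau | 0 <= tau]].
  by apply/mem_set; exists v0%:E => //=; rewrite lee_fin.
have h1 : Phi b (Phi_inv b w%:E) = w%:E by exact: pinvK.
have h2 : 0 <= Phi_inv b w%:E.
  have : set_fun (Phi b @` [set tau | 0 <= tau]) [set tau | 0 <= tau] (Phi_inv b).
    by move=> x xi; rewrite /Phi_inv; exact: funS.
  by move/set_mem : img => /[swap]; apply.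
exists (fine (Phi_inv b w%:E)).
have fi : Phi_inv b w%:E \is a fin_num.
  rewrite ge0_fin_numE// ltey; apply/negP => /eqP hy.
  by move: h1; rewrite hy Phiy.
split; [exact: fine_ge0|by rewrite fineK|].
have := Phi_EFin (fine_ge0 h2); rewrite fineK// h1.
by case.
Qed.
End Phi.

(** * Product measures and densities *)

Section product_integrals.
Local Open Scope ereal_scope.
Context {R : realType}.
Local Notation mR := (measurableTypeR R).
Local Notation leb := (@lebesgue_measure R).

(** Tonelli's theorem: [sigma_finite_product] is the product measure under a name of
its own. *)
Lemma integral_sigma_finite_product d1 d2 (T1 : measurableType d1)
    (T2 : measurableType d2) (m1 : {sigma_finite_measure set T1 -> \bar R})
    (m2 : {sigma_finite_measure set T2 -> \bar R}) (f : T1 * T2 -> \bar R) :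
  measurable_fun setT f -> (forall z, 0 <= f z) ->
  \int[sigma_finite_product m1 m2]_z f z =
  \int[m1]_x \int[m2]_y f (x, y).
Proof. by move=> mf f0; exact: (fubini_tonelli1 f mf f0). Qed.

Lemma integral_prodM d1 d2 (T1 : measurableType d1)
    (T2 : measurableType d2) (m1 : {sigma_finite_measure set T1 -> \bar R})
    (m2 : {sigma_finite_measure set T2 -> \bar R}) (f : T1 -> R) (g : T2 -> R)
    (a b : R) :
  measurable_fun setT f -> (forall z, 0 <= f z)%R ->
  measurable_fun setT g -> (forall z, 0 <= g z)%R ->
  \int[m1]_x (f x)%:E = a%:E -> \int[m2]_x (g x)%:E = b%:E ->
  \int[sigma_finite_product m1 m2]_z (f z.1 * g z.2)%:E = (a * b)%:E.
Proof.
move=> mf f0 mg g0 fa gb.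
rewrite integral_sigma_finite_product; last 2 first.
- apply/measurable_EFinP/measurable_funM.
    by apply: (measurableT_comp mf).
  by apply: (measurableT_comp mg).
- by move=> z; rewrite lee_fin mulr_ge0.
under eq_integral => x _.
  under eq_integral => y _ do rewrite /= EFinM.
  rewrite ge0_integralZl_EFin//; last 2 first.
  - by move=> y _; rewrite lee_fin.
  - exact/measurable_EFinP.
  rewrite gb muleC.
  over.
rewrite ge0_integralZl_EFin//; last 3 first.
- by move=> y _; rewrite lee_fin.
- exact/measurable_EFinP.
- by rewrite -lee_fin -gb; apply: integral_ge0 => x _; rewrite lee_fin.
by rewrite fa -EFinM mulrC.
Qed.

Lemma integral_tuple_prod n (h : 'I_n -> R -> R) (c : 'I_n -> R) :
  (forall i, measurable_fun setT (h i)) -> (forall i z, 0 <= h i z)%R ->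
  (forall i, \int[leb]_z (h i z)%:E = (c i)%:E) ->
  \int[lebesgue_tuple R n]_z (\prod_(i < n) h i (tnth z i))%:E =
  (\prod_(i < n) c i)%:E.
Proof.
elim: n h c => [|n ih] h c mh h0 hc.
  under eq_integral => z _ do rewrite big_ord0.
  rewrite big_ord0 integral_dirac// ?diracT ?mul1e//.
have mP : measurable_fun setT (fun z : n.+1.-tuple mR => (\prod_(i < n.+1) h i (tnth z i))%R).
  apply: measurable_prod => i _.
  by apply: (measurableT_comp (mh i)); exact: measurable_tnth.
rewrite [LHS](ge0_integral_pushforward (@measurable_cons_pair R n)) //=; last 2 first.
- exact/measurable_EFinP.
- by move=> z _; rewrite lee_fin; apply: prodr_ge0.
rewrite preimage_setT big_ord_recl.
pose g (z : n.-tuple mR) : R := (\prod_(i < n) h (lift ord0 i) (tnth z i))%R.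
have mg : measurable_fun setT g.
  apply: measurable_prod => i _.
  by apply: (measurableT_comp (mh _)); exact: measurable_tnth.
rewrite -(integral_prodM (m1 := leb) (m2 := lebesgue_tuple R n) (f := h ord0)
  (g := g)) //.
- apply: eq_integral => -[x z] _ /=; rewrite big_ord_recl/= tnth0.
  by under eq_bigr do rewrite tnthS.
- exact: mh.
- by move=> z; rewrite /g; apply: prodr_ge0 => i _; exact: h0.
- by apply: (ih (fun i => h (lift ord0 i)) (fun i => c (lift ord0 i))).
Qed.

End product_integrals.

Section density.
Local Open Scope ereal_scope.
Context d (T : measurableType d) (R : realType).
Variables (mu nu : {measure set T -> \bar R}) (h : T -> \bar R).
Hypotheses (mh : measurable_fun setT h) (h0 : forall x, 0 <= h x).
Hypothesis nuE : forall A, measurable A -> nu A = \int[mu]_(x in A) h x.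

Import HBNNSimple.

Let integral_density_nnsfun (g : {nnsfun T >-> R}) :
  \int[nu]_x (g x)%:E = \int[mu]_x ((g x)%:E * h x).
Proof.
transitivity (\int[nu]_x
   (\sum_(y \in range g) (y * \1_(g @^-1` [set y]) x)%:E)).
  by apply: eq_integral => t tE; rewrite /= fimfunE -fsumEFin.
have indich r : measurable_fun setT (fun x => (r * \1_(g @^-1` [set r]) x)%:E).
  by apply: (measurable_comp measurableT) => //; exact: measurable_funM.
rewrite ge0_integral_fsum//; last by move=> m y Ey; exact: nnfun_muleindic_ge0.
transitivity (\int[mu]_x (\sum_(y \in range g)
    (y * \1_(g @^-1` [set y]) x)%:E * h x)); last first.
  under [RHS]eq_integral => x xE.
    rewrite fimfunE -fsumEFin// ge0_mule_fsuml => [|y]; last exact: nnfun_muleindic_ge0.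
    over.
  by [].
rewrite ge0_integral_fsum//; last 2 first.
  - by move=> y; exact: emeasurable_funM.
  - by move=> m y Ey; rewrite mule_ge0// nnfun_muleindic_ge0.
apply: eq_fsbigr => r rg.
under eq_integral do rewrite EFinM.
under [RHS]eq_integral do rewrite EFinM -muleA.
have r0 : (0 <= r)%R by move: rg => /set_mem[x _ <-].
have mr : measurable (g @^-1` [set r]) by exact: measurable_funPTI.
rewrite ge0_integralZl_EFin//; last first.
  exact/measurable_EFinP.
rewrite ge0_integralZl_EFin//; last 2 first.
- by move=> x _; rewrite mule_ge0// lee_fin.
- by apply: emeasurable_funM => //; exact/measurable_EFinP.
congr (_ * _).
rewrite integral_indic// setIT nuE// integral_mkcond.
apply: eq_integral => x _; rewrite patchE indicE.
by case: ifPn => _; rewrite ?mul1e ?mul0e.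
Qed.

(** Both sides agree on simple functions.  In the passage to the limit the products
k x * h x with a zero factor are treated apart, since multiplication is not continuous
at 0 * +oo. *)
Lemma ge0_integral_density (k : T -> \bar R) : measurable_fun setT k ->
  (forall x, 0 <= k x) -> \int[nu]_x k x = \int[mu]_x (k x * h x).
Proof.
move=> mk k0; pose g := nnsfun_approx measurableT mk.
have gk x : ((g n x)%:E @[n --> \oo] --> k x) by exact: cvg_nnsfun_approx.
have ndg x (m n : nat) : (m <= n)%N -> ((g m x)%:E <= (g n x)%:E).
  by move=> mn; rewrite lee_fin; exact/lefP/nd_nnsfun_approx.
have gkh x : ((g n x)%:E * h x @[n --> \oo] --> k x * h x).
  have [k00|k00] := eqVneq (k x) 0.
    rewrite k00 mul0e (_ : (fun _ => _) = cst 0); first exact: cvg_cst.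
    apply/funext => n /=; rewrite (_ : (g n x)%:E = 0) ?mul0e//.
    apply/eqP; rewrite eq_le; apply/andP; split; last by rewrite lee_fin fun_ge0.
    rewrite -[leRHS]k00.
    rewrite -(cvg_lim _ (gk x))//; apply: lime_ge; first by apply/cvg_ex; eexists; exact: gk.
    by exists n => // m /= nm; exact: ndg.
  have [h00|h00] := eqVneq (h x) 0.
    rewrite h00 mule0 (_ : (fun _ => _) = cst 0); first exact: cvg_cst.
    by apply/funext => n /=; rewrite mule0.
  apply: cvgeM; [|exact: gk|exact: cvg_cst].
  by apply: neq0_mule_def; rewrite mule_eq0 negb_or k00.
transitivity (limn (fun n => \int[nu]_x (g n x)%:E)).
  rewrite -monotone_convergence//.
  - by apply: eq_integral => x _; apply/esym/cvg_lim.
  - by move=> n; exact/measurable_EFinP.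
  - by move=> n x _; rewrite lee_fin.
  - by move=> x _ m n mn; exact: ndg.
under eq_fun do rewrite integral_density_nnsfun.
rewrite -monotone_convergence//.
- by apply: eq_integral => x _; apply/cvg_lim.
- by move=> n; apply: emeasurable_funM => //; exact/measurable_EFinP.
- by move=> n x _; rewrite mule_ge0// lee_fin.
- by move=> x _ m n mn; apply: lee_wpmul2r => //; exact: ndg.
Qed.

End density.

(** * Gaussians on the line and on the half-line *)

Section gauss1.
Context {R : realType}.
Implicit Types a b t x y z m : R.
Local Notation leb := (@lebesgue_measure R).

(** The heat kernel of the line. *)
Definition gauss1 t z : R :=
  (4 * pi * t) `^ (- 2^-1) * expR (- (z ^+ 2 / (4 * t))).

Lemma gauss1_ge0 t z : 0 <= gauss1 t z.
Proof. by rewrite mulr_ge0 ?powR_ge0// expR_ge0. Qed.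

Lemma gauss1N t z : gauss1 t (- z) = gauss1 t z.
Proof. by rewrite /gauss1 sqrrN. Qed.

Let sd t : R := Num.sqrt (2 * t).

Let sd_neq0 t : 0 < t -> sd t != 0.
Proof. by move=> t0; rewrite gt_eqF// sqrtr_gt0 mulr_gt0. Qed.

Lemma gauss1E t z m : 0 < t -> gauss1 t (z - m) = normal_pdf m (sd t) z.
Proof.
move=> t0; rewrite normal_pdfE ?sd_neq0// /normal_peak /normal_fun.
rewrite sqr_sqrtr; last by rewrite mulr_ge0// ltW.
congr (_ * expR _).
  rewrite powRN powR12_sqrt; last by rewrite !mulr_ge0 ?pi_ge0// ltW.
  by congr (Num.sqrt _)^-1; rewrite -mulr_natr; ring.
by rewrite mulNr; congr (- (_ / _)); rewrite -mulr_natr; ring.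
Qed.

Lemma measurable_gauss1 t : measurable_fun setT (gauss1 t).
Proof.
apply: measurable_funM => //; apply: (measurableT_comp (@measurable_expR R)).
apply: measurable_funN; apply: measurable_funM => //.
Qed.

Lemma integral_gauss1 t m : 0 < t ->
  (\int[leb]_z (gauss1 t (m - z))%:E = 1)%E.
Proof.
move=> t0; rewrite -(integral_normal_pdf m (sd t)).
by apply: eq_integral => z _; rewrite -gauss1E// -gauss1N opprB.
Qed.

(** Even in z, with total mass 2, hence of mass 1 on the half-line: Gaussians on the
half-line are only integrated in such pairs of opposite means. *)
Let half_normal m s z : R := normal_pdf m s z + normal_pdf (- m) s z.

Let integral_half_normal m s : s != 0 ->
  (\int[leb]_(z in `]0%R, +oo[) (half_normal m s z)%:E = 1)%E.
Proof.
move=> s0; pose f z := half_normal m s z.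
have f0 z : 0 <= f z by rewrite addr_ge0// normal_pdf_ge0.
have cf : continuous f.
  by move=> z; apply: cvgD; exact: continuous_normal_pdf.
have ef : f =1 f \o -%R.
  have nN c z : normal_pdf (- c) s z = normal_pdf c s (- z).
    rewrite !normal_pdfE// /normal_fun.
    have -> : z - - c = - (- z - c) by ring.
    by rewrite sqrrN.
  by move=> z; rewrite /f /half_normal/= (nN m z) (nN m (- z)) opprK addrC.
have := ge0_symfun_integralT f0 cf ef.
have -> : (\int[leb]_z (f z)%:E = 2%:E)%E.
  rewrite (_ : 2%:E = 1 + 1)%E; last by rewrite -EFinD.
  rewrite -{1}(integral_normal_pdf m s) -(integral_normal_pdf (- m) s).
  rewrite -ge0_integralD//.
  - by move=> z _; rewrite lee_fin normal_pdf_ge0.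
  - by apply/measurable_EFinP; exact: measurable_normal_pdf.
  - by move=> z _; rewrite lee_fin normal_pdf_ge0.
  - by apply/measurable_EFinP; exact: measurable_normal_pdf.
have mf : measurable_fun setT f by exact: continuous_measurable_fun.
rewrite -set_itvcy integral_itv_obnd_cbnd; last first.
  by apply/measurable_EFinP; exact: measurable_funTS.
have : (0 <= \int[leb]_(z in `[0%R, +oo[) (f z)%:E)%E.
  by apply: integral_ge0 => z _; rewrite lee_fin.
rewrite -/f; case: (\int[leb]_(z in `[0%R, +oo[) (f z)%:E)%E => [r| |] //=.
  by move=> _; rewrite -EFinM => -[] h; congr EFin; lra.
by move=> _; rewrite mulry gtr0_sg// mul1e.
Qed.

(** Completing the square in z. *)
Lemma gauss1_mul a b x y z : 0 < a -> 0 < b ->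
  gauss1 a (x - z) * gauss1 b (z - y) = gauss1 (a + b) (x - y) *
    normal_pdf ((b * x + a * y) / (a + b)) (sd (a * b / (a + b))) z.
Proof.
move=> a0 b0; have ab0 : 0 < a + b by exact: addr_gt0.
have s0 : 0 < a * b / (a + b) by rewrite divr_gt0// mulr_gt0.
have p0 := pi_gt0 R.
have h4 t : 0 < t -> 0 <= 4 * pi * t by move=> t0; rewrite !mulr_ge0 ?pi_ge0// ltW.
rewrite -gauss1E// /gauss1 mulrACA [RHS]mulrACA; congr (_ * _).
  rewrite -!powRM ?h4//; congr (_ `^ _).
  by field; rewrite gt_eqF.
rewrite -!expRD; congr expR; field.
by rewrite !gt_eqF.
Qed.

(** The Dirichlet heat kernel of the half-line, by reflection. *)
Definition half_gauss1 t x y : R := gauss1 t (x - y) - gauss1 t (x + y).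

Lemma half_gauss1E t x y : 0 < t ->
  half_gauss1 t x y = gauss1 t (x - y) * (1 - expR (- (x * y / t))).
Proof.
move=> t0; rewrite /half_gauss1 mulrBr mulr1; congr (_ - _).
rewrite /gauss1 -[RHS]mulrA -expRD; congr (_ * expR _); field.
by rewrite gt_eqF.
Qed.

Lemma half_gauss1_ge0 t x y : 0 < t -> 0 <= x -> 0 <= y ->
  0 <= half_gauss1 t x y.
Proof.
move=> t0 x0 y0; rewrite half_gauss1E// mulr_ge0 ?gauss1_ge0//.
rewrite subr_ge0 -expR0 ler_expR oppr_le0 divr_ge0 ?mulr_ge0//; exact: ltW.
Qed.

(** Expanding the two reflections gives four Gaussians in z, whose means come in
opposite pairs; on the half-line each pair integrates to 1.  The negative terms A are
moved to the other side, so that only nonnegative functions are integrated. *)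
Lemma integral_half_gauss1 a b x y : 0 < a -> 0 < b -> 0 <= x -> 0 <= y ->
  (\int[leb]_(z in `]0%R, +oo[) (half_gauss1 a x z * half_gauss1 b z y)%:E =
   (half_gauss1 (a + b) x y)%:E)%E.
Proof.
move=> a0 b0 x0 y0; have ab0 : 0 < a + b by exact: addr_gt0.
pose s := sd (a * b / (a + b)).
have s0 : s != 0 by rewrite sd_neq0// divr_gt0// mulr_gt0.
pose m1 := (b * x + a * y) / (a + b).
pose m2 := (b * x - a * y) / (a + b).
pose P z := half_gauss1 a x z * half_gauss1 b z y.
pose A z := gauss1 (a + b) (x + y) * half_normal m2 s z.
pose B z := gauss1 (a + b) (x - y) * half_normal m1 s z.
have mhn m : measurable_fun setT (half_normal m s).
  by apply: measurable_funD; exact: measurable_normal_pdf.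
have hn0 m z : 0 <= half_normal m s z.
  by rewrite addr_ge0// normal_pdf_ge0.
have mA : measurable_fun setT A by exact: measurable_funM.
have mB : measurable_fun setT B by exact: measurable_funM.
have PAB z : P z + A z = B z.
  have h1 := gauss1_mul x y z a0 b0.
  have h2 := gauss1_mul x (- y) z a0 b0.
  have h3 := gauss1_mul (- x) y z a0 b0.
  have h4 := gauss1_mul (- x) (- y) z a0 b0.
  rewrite !opprK in h2 h4.
  rewrite -[- x - z]opprD gauss1N in h3 h4.
  rewrite -[- x - y]opprD gauss1N in h3.
  rewrite [- x + y]addrC -[y - x]opprB gauss1N in h4.
  rewrite /P /A /B /half_gauss1 /half_normal mulrBl !mulrBr h1 h2 h3 h4.
  have -> : (b * x + a * - y) / (a + b) = m2 by rewrite /m2; congr (_ / _); ring.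
  have -> : (b * - x + a * y) / (a + b) = - m2.
    by rewrite /m2 -mulNr; congr (_ / _); ring.
  have -> : (b * - x + a * - y) / (a + b) = - m1.
    by rewrite /m1 -mulNr; congr (_ / _); ring.
  rewrite -/m1 -/s; ring.
have mP : measurable_fun setT P.
  rewrite (_ : P = B \- A); first exact: measurable_funB.
  by apply/funext => z; rewrite /= -PAB addrK.
have P0 z : 0 < z -> 0 <= P z.
  by move=> z0; rewrite mulr_ge0// half_gauss1_ge0// ltW.
have A0 z : 0 <= A z by rewrite mulr_ge0// gauss1_ge0.
have IC (c m : R) : 0 <= c ->
    (\int[leb]_(z in `]0%R, +oo[) (c * half_normal m s z)%:E = c%:E)%E.
  move=> c0; under eq_integral do rewrite EFinM.
  rewrite ge0_integralZl_EFin//.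
  - by rewrite integral_half_normal// mule1.
  - by move=> z _; rewrite lee_fin.
  - by apply/measurable_EFinP; exact: measurable_funTS (mhn m).
have : (\int[leb]_(z in `]0%R, +oo[) (P z)%:E +
        \int[leb]_(z in `]0%R, +oo[) (A z)%:E =
        \int[leb]_(z in `]0%R, +oo[) (B z)%:E)%E.
  rewrite -ge0_integralD//.
  - by apply: eq_integral => z _; rewrite -EFinD PAB.
  - by move=> z /=; rewrite in_itv/= andbT lee_fin => /P0.
  - by apply/measurable_EFinP; exact: measurable_funTS.
  - by move=> z _; rewrite lee_fin.
  - by apply/measurable_EFinP; exact: measurable_funTS.
rewrite /A /B !IC ?gauss1_ge0// -/(P _) => h.
transitivity ((gauss1 (a + b) (x - y))%:E - (gauss1 (a + b) (x + y))%:E)%E.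
  by rewrite -h addeK.
by rewrite -EFinB.
Qed.

End gauss1.

(** * The Dirichlet heat kernel of the half-space *)

Section kernel.
Context {R : realType} {N : nat}.
Hypothesis hN : (1 <= N)%N.
Local Notation X := (coord_space R N).
Local Notation mR := (measurableTypeR R).
Local Notation leb := (@lebesgue_measure R).
Local Notation lebX := (@lebesgue_space R N).
Implicit Types x y z : X.

Lemma enormE x : enorm x ^+ 2 = (\sum_(i < N.-1) (tnth x.1 i : R) ^+ 2) + xN x ^+ 2.
Proof.
rewrite /enorm sqr_sqrtr// addr_ge0 ?sqr_ge0//.
by apply: sumr_ge0 => i _; exact: sqr_ge0.
Qed.

Lemma sub_spaceE x y i : tnth (sub_space x y).1 i = (tnth x.1 i : R) - tnth y.1 i.
Proof. by rewrite /sub_space/= tnth_mktuple. Qed.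

Lemma Gamma_prod_gauss1 x t : 0 < t ->
  Gamma x t = (\prod_(i < N.-1) gauss1 t (tnth x.1 i)) * gauss1 t (xN x).
Proof.
move=> t0; have p0 : 0 <= 4 * pi * t by rewrite !mulr_ge0 ?pi_ge0// ltW.
rewrite /Gamma /gauss1 big_split/= prodr_const card_ord mulrACA -exprSr.
congr (_ * _).
  rewrite -powR_mulrn ?powR_ge0// -powRrM prednK// mulNr.
  by congr (_ `^ (- _)); rewrite mulrC.
rewrite -expR_sum -expRD; congr expR.
rewrite enormE mulrDl opprD; congr (_ + _).
by rewrite mulr_suml sumrN.
Qed.

Lemma Gamma_sub_prod_gauss1 x y t : 0 < t ->
  Gamma (sub_space x y) t =
  (\prod_(i < N.-1) gauss1 t ((tnth x.1 i : R) - tnth y.1 i)) * gauss1 t (xN x - xN y).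
Proof.
move=> t0; rewrite Gamma_prod_gauss1//; congr (_ * _).
by apply: eq_bigr => i _; rewrite sub_spaceE.
Qed.

(** The boundary factor of G only involves the last coordinate: it turns the Gaussian
of the line into the kernel of the half-line. *)
Lemma G_prod_gauss1 x y t : 0 < t ->
  G x y t =
  (\prod_(i < N.-1) gauss1 t ((tnth x.1 i : R) - tnth y.1 i)) *
  half_gauss1 t (xN x) (xN y).
Proof. by move=> t0; rewrite /G Gamma_sub_prod_gauss1// -mulrA -half_gauss1E. Qed.

Lemma Gamma_ge0 x t : 0 <= Gamma x t.
Proof. by rewrite mulr_ge0 ?powR_ge0 ?expR_ge0. Qed.

Lemma G_ge0 x y t : 0 < t -> 0 <= xN x -> 0 <= xN y -> 0 <= G x y t.
Proof.
move=> t0 x0 y0; rewrite mulr_ge0 ?Gamma_ge0// subr_ge0 -expR0 ler_expR.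
by rewrite oppr_le0 divr_ge0 ?mulr_ge0// ltW.
Qed.

Lemma G_le_Gamma x y t : G x y t <= Gamma (sub_space x y) t.
Proof.
by rewrite ler_piMr ?Gamma_ge0// gerBl expR_ge0.
Qed.

Lemma measurable_Omega : measurable (@Omega R N).
Proof.
rewrite (_ : Omega = setT `&` @xN R N @^-1` `]0%R, +oo[%classic).
  exact: measurable_snd.
by apply/seteqP; split => x /=; rewrite in_itv/= andbT// => -[].
Qed.

Lemma measurable_Omegabar : measurable (@Omegabar R N).
Proof.
rewrite (_ : Omegabar = setT `&` @xN R N @^-1` `[0%R, +oo[%classic).
  exact: measurable_snd.
by apply/seteqP; split => x /=; rewrite in_itv/= andbT// => -[].
Qed.

Lemma measurable_xN_comp d (W : measurableType d) (a : W -> X) :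
  measurable_fun setT a -> measurable_fun setT (fun w => xN (a w)).
Proof. by move=> ma; apply: (measurableT_comp measurable_snd). Qed.

Lemma measurable_enorm_sub_sqr_comp d (W : measurableType d) (a c : W -> X) :
  measurable_fun setT a -> measurable_fun setT c ->
  measurable_fun setT (fun w => enorm (sub_space (a w) (c w)) ^+ 2).
Proof.
move=> ma mc; under eq_fun do rewrite enormE.
have mX (u : W -> R) : measurable_fun setT u -> measurable_fun setT (fun w : W => u w ^+ 2).
  by move=> mu; exact: measurable_funX.
apply: measurable_funD.
  apply: measurable_sum => i; apply: mX.
  under eq_fun do rewrite sub_spaceE.
  apply: measurable_funB.
    by apply: (measurableT_comp (measurable_tnth i)); exact: (measurableT_comp measurable_fst).
  by apply: (measurableT_comp (measurable_tnth i)); exact: (measurableT_comp measurable_fst).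
by apply: mX; apply: measurable_funB; exact: measurable_xN_comp.
Qed.

Lemma measurable_Gamma_sub_comp d (W : measurableType d) (a c : W -> X)
    (tt : W -> R) :
  measurable_fun setT a -> measurable_fun setT c -> measurable_fun setT tt ->
  measurable_fun setT (fun w => Gamma (sub_space (a w) (c w)) (tt w)).
Proof.
move=> ma mc mt.
have mt4 : measurable_fun setT (fun w => (4 * tt w)^-1).
  by apply: (measurableT_comp measurable_invr); exact: measurable_funM.
apply: measurable_funM.
  apply: (measurableT_comp (measurable_powR _)).
  exact: measurable_funM.
apply: (measurableT_comp (@measurable_expR R)).
apply: measurable_funN; apply: measurable_funM => //.
exact: measurable_enorm_sub_sqr_comp.
Qed.

Lemma measurable_G_comp d (W : measurableType d) (a c : W -> X) (tt : W -> R) :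
  measurable_fun setT a -> measurable_fun setT c -> measurable_fun setT tt ->
  measurable_fun setT (fun w => G (a w) (c w) (tt w)).
Proof.
move=> ma mc mt; apply: measurable_funM.
  exact: measurable_Gamma_sub_comp.
apply: measurable_funB => //; apply: (measurableT_comp (@measurable_expR R)).
apply: measurable_funN; apply: measurable_funM.
  by apply: measurable_funM; exact: measurable_xN_comp.
exact: (measurableT_comp measurable_invr).
Qed.

Lemma integral_Omega_prod (h : 'I_(N.-1) -> R -> R) (c : 'I_(N.-1) -> R)
    (g : R -> R) (d : R) :
  (forall i, measurable_fun setT (h i)) -> (forall i (r : R), 0 <= h i r) ->
  (forall i, \int[leb]_r (h i r)%:E = (c i)%:E)%E ->
  measurable_fun setT g -> (forall r : R, 0 < r -> 0 <= g r) ->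
  (\int[leb]_(r in `]0%R, +oo[) (g r)%:E = d%:E)%E ->
  (\int[lebX]_(z in Omega) ((\prod_(i < N.-1) h i (tnth z.1 i)) * g (xN z))%:E =
   ((\prod_(i < N.-1) c i) * d)%:E)%E.
Proof.
move=> mh h0 hc mg g0 gd.
pose g' := g \_ `]0%R, +oo[%classic.
have g'E (z : R) : g' z = if 0 < z then g z else 0.
  by rewrite /g' patchE mem_setE in_itv/= andbT.
pose H (z : (N.-1).-tuple mR) : R := \prod_(i < N.-1) h i (tnth z i).
rewrite integral_mkcond.
rewrite -(integral_prodM (m1 := lebesgue_tuple R N.-1) (m2 := leb)
  (f := H) (g := g')) //.
- apply: eq_integral => z _; rewrite patchE g'E -/(H _).
  rewrite (_ : (z \in Omega) = (0 < xN z)); last first.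
    by apply/idP/idP => [/set_mem|/mem_set].
  by case: ifPn => //; rewrite mulr0.
- apply: measurable_prod => i _.
  by apply: (measurableT_comp (mh _)); exact: measurable_tnth.
- by move=> z; apply: prodr_ge0.
- by apply/(measurable_restrictT _ _).1 => //; exact: measurable_funTS.
- by move=> z; rewrite g'E; case: ifPn => // /g0.
- exact: integral_tuple_prod.
- rewrite -gd [RHS]integral_mkcond; apply: eq_integral => z _.
  by rewrite restrict_EFin.
Qed.

End kernel.

Section kernel_estimates.
Context {R : realType} {N : nat}.
Hypothesis hN : (1 <= N)%N.
Local Notation X := (coord_space R N).
Local Notation mR := (measurableTypeR R).
Local Notation leb := (@lebesgue_measure R).
Local Notation lebX := (@lebesgue_space R N).
Implicit Types x y z : X.

Lemma measurable_EFin_Gamma x t :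
  measurable_fun setT (fun y => (Gamma (sub_space x y) t)%:E).
Proof.
by apply/measurable_EFinP; exact: measurable_Gamma_sub_comp.
Qed.

Lemma measurable_EFin_G x t :
  measurable_fun setT (fun y => (G x y t)%:E).
Proof. by apply/measurable_EFinP; exact: measurable_G_comp. Qed.

Lemma integral_Gamma_Omega_le1 x t : 0 < t ->
  (\int[lebX]_(y in Omega) (Gamma (sub_space x y) t)%:E <= 1)%E.
Proof.
move=> t0; apply: (@le_trans _ _ (\int[lebX]_y (Gamma (sub_space x y) t)%:E)%E).
  apply: ge0_subset_integral => //; first exact: measurable_Omega.
  - exact: measurable_EFin_Gamma.
  - by move=> y _; rewrite lee_fin Gamma_ge0.
pose h (i : 'I_N.-1) (r : R) := gauss1 t (tnth x.1 i - r).
pose H (z : (N.-1).-tuple mR) : R := \prod_(i < N.-1) h i (tnth z i).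
have mg (c : R) : measurable_fun setT (fun r : R => gauss1 t (c - r)).
  apply: (measurableT_comp (measurable_gauss1 t)).
  exact: measurable_funB.
have := @integral_prodM R _ _ _ _ (lebesgue_tuple R N.-1) leb H
  (fun r : R => gauss1 t (xN x - r)) 1 1.
rewrite mulr1 => h1; rewrite le_eqVlt; apply/orP; left; apply/eqP.
rewrite -[RHS]h1 //.
- by apply: eq_integral => y _; rewrite Gamma_sub_prod_gauss1.
- apply: measurable_prod => i _.
  by apply: (measurableT_comp (mg (tnth x.1 i))); exact: measurable_tnth.
- by move=> z; apply: prodr_ge0 => i _; exact: gauss1_ge0.
- exact: mg.
- by move=> z; exact: gauss1_ge0.
- rewrite (_ : 1%:E = (\prod_(i < N.-1) 1)%:E)%E; last by rewrite big1_eq.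
  apply: integral_tuple_prod => //.
  - by move=> i; exact: mg.
  - by move=> i r; exact: gauss1_ge0.
  - by move=> i; exact: integral_gauss1.
- exact: integral_gauss1.
Qed.

Lemma integral_G_le1 x t : 0 < t -> 0 <= xN x ->
  (\int[lebX]_(y in Omega) (G x y t)%:E <= 1)%E.
Proof.
move=> t0 x0; apply: le_trans (integral_Gamma_Omega_le1 x t0).
apply: ge0_le_integral => //; first exact: measurable_Omega.
- by move=> y y0; rewrite lee_fin G_ge0// ltW.
- by apply: measurable_funTS; exact: measurable_EFin_G.
- by apply: measurable_funTS; exact: measurable_EFin_Gamma.
- by move=> y _; rewrite lee_fin G_le_Gamma.
Qed.

Lemma G_semigroup x y a b : 0 < a -> 0 < b -> 0 <= xN x -> 0 <= xN y ->
  (\int[lebX]_(z in Omega) (G x z a * G z y b)%:E = (G x y (a + b))%:E)%E.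
Proof.
move=> a0 b0 x0 y0; have ab0 : 0 < a + b by exact: addr_gt0.
rewrite G_prod_gauss1//.
rewrite -(@integral_Omega_prod R N
 (fun i (r : R) => gauss1 a (tnth x.1 i - r) * gauss1 b (r - tnth y.1 i))
 (fun i => gauss1 (a + b) ((tnth x.1 i : R) - tnth y.1 i))
 (fun r : R => half_gauss1 a (xN x) r * half_gauss1 b r (xN y))).
- apply: eq_integral => z _; rewrite !G_prod_gauss1// mulrACA; congr (_ * _)%:E.
  by rewrite -big_split.
- move=> i; apply: measurable_funM.
    apply: (measurableT_comp (measurable_gauss1 a)); exact: measurable_funB.
  by apply: (measurableT_comp (measurable_gauss1 b)); exact: measurable_funB.
- by move=> i r; rewrite mulr_ge0 ?gauss1_ge0.
- move=> i; under eq_integral do rewrite gauss1_mul//.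
  under eq_integral do rewrite EFinM.
  rewrite ge0_integralZl_EFin//.
  + by rewrite integral_normal_pdf mule1.
  + by move=> r _; rewrite lee_fin normal_pdf_ge0.
  + by apply/measurable_EFinP; exact: measurable_normal_pdf.
  + exact: gauss1_ge0.
- have mg c (s : R -> R) : measurable_fun setT s ->
      measurable_fun setT (fun r : R => gauss1 c (s r)).
    by move=> ms; apply: (measurableT_comp (measurable_gauss1 c)).
  apply: measurable_funM; apply: measurable_funB; apply: mg.
  + exact: measurable_funB.
  + exact: measurable_funD.
  + exact: measurable_funB.
  + exact: measurable_funD.
- by move=> r r0; rewrite mulr_ge0// half_gauss1_ge0// ltW.
- exact: integral_half_gauss1.
Qed.

(** With D and Y the distance from x to y and the height of y in units of sqrt t, the
argument q = x_N y_N / t is at most (Y + D) Y.  If Y >= 1 the left-hand side is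
bounded by 1; otherwise q <= (1 + D) Y and Y <= Y^l. *)
Let one_sub_expRN_le (l D Y q : R) : 0 <= l <= 1 -> 0 <= D -> 0 < Y ->
  q <= (Y + D) * Y -> 1 - expR (- q) <= (1 + D) * Y `^ l.
Proof.
move=> /andP[l0 l1] D0 Y0 qY.
have [Y1|Y1] := leP 1 Y.
  apply: (@le_trans _ _ 1); first by rewrite gerBl expR_ge0.
  rewrite -[leLHS]mulr1; apply: ler_pM => //; first by rewrite lerDl.
  by rewrite -[leLHS](powRr0 Y); exact: ler_powR.
apply: (@le_trans _ _ q).
  by rewrite lerBlDr -lerBlDl; have := @expR_ge1Dx R (- q).
apply: (le_trans qY); apply: ler_pM => //;
  [by rewrite addr_ge0// ltW|exact: ltW|by rewrite lerD2r ltW|].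
by rewrite ger1_powR// Y0 ltW.
Qed.

Lemma enorm_ge0 x : 0 <= enorm x. Proof. exact: sqrtr_ge0. Qed.

Lemma norm_xN_le_enorm x : `|xN x| <= enorm x.
Proof.
rewrite -sqrtr_sqr /enorm ler_wsqrtr// lerDr.
by apply: sumr_ge0 => i _; exact: sqr_ge0.
Qed.

Lemma Gamma_dilate (s : R) x t : 0 < s -> 0 < t -> Gamma x (s * t) =
  s `^ (- (N%:R / 2)) * (4 * pi * t) `^ (- (N%:R / 2)) *
  expR (- (enorm x ^+ 2 / (4 * (s * t)))).
Proof.
move=> s0 t0; rewrite /Gamma -powRM//; first by congr (_ `^ _ * _); ring.
- exact: ltW.
- by rewrite !mulr_ge0 ?pi_ge0// ltW.
Qed.

(** The factor 1 + D is absorbed by half of the Gaussian, which doubles the time. *)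
Lemma G_le_weight (l : R) x y t : 0 <= l <= 1 -> 0 < t -> 0 < xN x -> 0 < xN y ->
  G x y t <= 4 * 2 `^ (N%:R / 2) * t `^ (- (l / 2)) *
             (xN y `^ l * Gamma (sub_space x y) (2 * t)).
Proof.
move=> hl t0 x0 y0.
set w := sub_space x y.
pose st := Num.sqrt t.
have st0 : 0 < st by rewrite sqrtr_gt0.
have stE : st * st = t by rewrite -expr2 sqr_sqrtr// ltW.
pose D := enorm w / st; pose Y := xN y / st.
have D0 : 0 <= D by rewrite divr_ge0 ?enorm_ge0// ltW.
have Y0 : 0 < Y by rewrite divr_gt0.
have h2 : 0 < (2 : R) `^ (N%:R / 2) by rewrite powR_gt0.
have P0 : 0 < (4 * pi * t) `^ (- (N%:R / 2)) by rewrite powR_gt0// !mulr_gt0// pi_gt0.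
have q1 : 1 - expR (- (xN x * xN y / t)) <= (1 + D) * Y `^ l.
  apply: one_sub_expRN_le => //.
  rewrite -stE invfM mulrACA; apply: ler_wpM2r; first exact: ltW.
  rewrite -mulrDl; apply: ler_wpM2r; first by rewrite invr_ge0 ltW.
  have := norm_xN_le_enorm w; have := ler_norm (xN w).
  have -> : xN w = xN x - xN y by [].
  lra.
have D4 : expR (- (D ^+ 2 / 8)) * (1 + D) <= 4.
  rewrite expRN mulrC ler_pdivrMr ?expR_gt0//.
  have := @expR_ge1Dx R (D ^+ 2 / 8); nra.
have YE : Y `^ l = t `^ (- (l / 2)) * xN y `^ l.
  rewrite /Y powRM ?ltW// ?invr_gt0// mulrC; congr (_ * _).
  have -> : st^-1 = t `^ (- 2^-1) by rewrite powRN powR12_sqrt ?(ltW t0).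
  by rewrite -powRrM; congr (_ `^ _); field.
rewrite Gamma_dilate//.
have -> : 4 * 2 `^ (N%:R / 2) * t `^ (- (l / 2)) *
   (xN y `^ l * (2 `^ (- (N%:R / 2)) * (4 * pi * t) `^ (- (N%:R / 2)) *
     expR (- (enorm w ^+ 2 / (4 * (2 * t)))))) =
   (4 * pi * t) `^ (- (N%:R / 2)) * (expR (- (D ^+ 2 / 8)) * (4 * Y `^ l)).
  rewrite YE (powRN 2).
  have -> : enorm w ^+ 2 / (4 * (2 * t)) = D ^+ 2 / 8.
    by rewrite -stE /D; field; rewrite gt_eqF.
  by field; rewrite !gt_eqF//.
have -> : G x y t = (4 * pi * t) `^ (- (N%:R / 2)) *
    (expR (- (D ^+ 2 / 8)) * (expR (- (D ^+ 2 / 8)) * (1 - expR (- (xN x * xN y / t))))).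
  rewrite /G /Gamma -/w -!mulrA; congr (_ * _); rewrite [RHS]mulrA -expRD; congr (expR _ * _).
  by rewrite -stE /D; field; rewrite gt_eqF.
apply: ler_wpM2l; first exact: ltW.
apply: ler_wpM2l; first exact: expR_ge0.
apply: (@le_trans _ _ (expR (- (D ^+ 2 / 8)) * ((1 + D) * Y `^ l))).
  by apply: ler_wpM2l => //; exact: expR_ge0.
by rewrite mulrA; apply: ler_wpM2r => //; exact: powR_ge0.
Qed.

End kernel_estimates.

(** * Smoothing from uniformly local bounds *)

Section smoothing.
Context {R : realType} {N : nat}.
Hypothesis hN : (1 <= N)%N.
Local Notation X := (coord_space R N).
Local Notation mR := (measurableTypeR R).
Local Notation leb := (@lebesgue_measure R).
Local Notation lebX := (@lebesgue_space R N).
Implicit Types x y z : X.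

Lemma enorm_sub_spaceC x y : enorm (sub_space x y) = enorm (sub_space y x).
Proof.
rewrite /enorm; congr (Num.sqrt (_ + _)).
  by apply: eq_bigr => i _; rewrite !sub_spaceE -sqrrN opprB.
by rewrite -sqrrN opprB.
Qed.

Lemma enorm_sub_space_sqr_le x y z :
  enorm (sub_space x z) ^+ 2 <=
  2 * enorm (sub_space x y) ^+ 2 + 2 * enorm (sub_space y z) ^+ 2.
Proof.
have h (a b c : R) : (a - c) ^+ 2 <= 2 * (a - b) ^+ 2 + 2 * (b - c) ^+ 2.
  rewrite -subr_ge0 (_ : _ - _ = (a - 2 * b + c) ^+ 2) ?sqr_ge0//; ring.
rewrite !enormE !mulrDr addrACA; apply: lerD; last exact: h.
rewrite !mulr_sumr -big_split/=; apply: ler_sum => i _.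
by rewrite !sub_spaceE; exact: h.
Qed.

(** Up to a null set this is [BOmega y r]; the center comes first in [sub_space], so
that the same expression serves both variables in Tonelli's theorem. *)
Definition ball_Omega y (r : R) : set X :=
  Omega `&` [set z | enorm (sub_space y z) < r].

Lemma measurable_enorm_sub_comp d (W : measurableType d) (a c : W -> X) :
  measurable_fun setT a -> measurable_fun setT c ->
  measurable_fun setT (fun w => enorm (sub_space (a w) (c w))).
Proof.
move=> ma mc.
rewrite (_ : (fun _ => _) = (fun w => Num.sqrt (enorm (sub_space (a w) (c w)) ^+ 2))).
  apply: (measurableT_comp (continuous_measurable_fun (@sqrt_continuous R))).
  exact: measurable_enorm_sub_sqr_comp.
by apply/funext => w; rewrite sqrtr_sqr ger0_norm// enorm_ge0.
Qed.

Lemma measurable_ball_Omega y r : measurable (ball_Omega y r).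
Proof.
apply: measurableI; first exact: measurable_Omega.
rewrite -[X in measurable X]setTI.
have mf : measurable_fun setT (fun z => enorm (sub_space y z)).
  exact: measurable_enorm_sub_comp.
have := mf measurableT `]-oo, r[%classic (measurable_itv _).
congr (measurable (_ `&` _)); apply/seteqP; split => z /=; by rewrite in_itv.
Qed.

(** Since |x - z|^2 <= 2 |x - y|^2 + 2 |y - z|^2, moving the center by at most sqrt t is
paid for by doubling the time. *)
Let Gamma_le_Gamma_ball x y z t : 0 < t ->
  enorm (sub_space y z) < Num.sqrt t ->
  2 `^ (- (N%:R / 2)) * expR (- 8^-1) * Gamma (sub_space x y) (2 * t) <=
  Gamma (sub_space x z) (4 * t).
Proof.
move=> t0 yz.
have P0 : 0 < (4 * pi * t : R) `^ (- (N%:R / 2)).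
  by rewrite powR_gt0// !mulr_gt0// pi_gt0.
rewrite !Gamma_dilate//.
have -> : (4 : R) `^ (- (N%:R / 2)) = 2 `^ (- (N%:R / 2)) * 2 `^ (- (N%:R / 2)).
  by rewrite -powRM//; congr (_ `^ _); ring.
set p := 2 `^ _; set P := (4 * pi * t) `^ _.
have -> : p * expR (- 8^-1) * (p * P * expR (- (enorm (sub_space x y) ^+ 2 / (4 * (2 * t))))) =
  p * p * P * (expR (- 8^-1) * expR (- (enorm (sub_space x y) ^+ 2 / (4 * (2 * t))))) by ring.
apply: ler_wpM2l; first by rewrite !mulr_ge0// ?powR_ge0// ltW.
rewrite -expRD ler_expR -opprD lerN2.
have yz2 : enorm (sub_space y z) ^+ 2 <= t.
  rewrite -[leRHS](sqr_sqrtr (ltW t0)); apply: lerXn2r => //; rewrite ?nnegrE.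
  - exact: enorm_ge0.
  - exact: sqrtr_ge0.
  - exact: ltW.
rewrite (_ : 8^-1 + _ = (2 * t + 2 * enorm (sub_space x y) ^+ 2) / (4 * (4 * t))); last first.
  by field; rewrite gt_eqF.
apply: ler_wpM2r; first by rewrite invr_ge0 !mulr_ge0// ltW.
have := enorm_sub_space_sqr_le x y z; lra.
Qed.

Let indic_int_shift (c r : R) : 0 < r ->
  (\int[leb]_s (\1_`]c, (c + r)[ s)%:E = r%:E)%E.
Proof.
move=> r0; rewrite integral_indic//= setIT lebesgue_measure_itv/= lte_fin ltrDl r0.
by rewrite -EFinB addrAC subrr add0r.
Qed.

(** The ball around y contains the cube with lowest vertex y and side sqrt t / N, which
stays inside the half-space, and on which the Gaussian of time 4 t is at least a
constant times that of time 2 t at y. *)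
Lemma Gamma_le_average : exists2 C : R, 0 < C & forall x y t, 0 < t -> 0 < xN y ->
  ((Gamma (sub_space x y) (2 * t))%:E <= (C * t `^ (- (N%:R / 2)))%:E *
   \int[lebX]_(z in ball_Omega y (Num.sqrt t)) (Gamma (sub_space x z) (4 * t))%:E)%E.
Proof.
have N0 : 0 < N%:R :> R by rewrite ltr0n.
pose c : R := 2 `^ (- (N%:R / 2)) * expR (- 8^-1).
have c0 : 0 < c by rewrite mulr_gt0 ?powR_gt0 ?expR_gt0.
exists ((c * N%:R^-1 ^+ N)^-1).
  by rewrite invr_gt0 mulr_gt0// exprn_gt0// invr_gt0.
move=> x y t t0 y0.
pose r := Num.sqrt t / N%:R.
have st0 : 0 < Num.sqrt t by rewrite sqrtr_gt0.
have r0 : 0 < r by rewrite divr_gt0.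
pose g := Gamma (sub_space x y) (2 * t).
pose box z : R := (\prod_(i < N.-1) \1_`]tnth y.1 i, (tnth y.1 i + r)[ (tnth z.1 i)) *
    \1_`]xN y, (xN y + r)[ (xN z).
have boxr : (\int[lebX]_(z in Omega) (box z)%:E = (r ^+ N)%:E)%E.
  rewrite (@integral_Omega_prod R N (fun i => \1_`]tnth y.1 i, (tnth y.1 i + r)[)
     (fun=> r) (\1_`]xN y, (xN y + r)[) r)//.
  - by rewrite prodr_const card_ord -exprSr prednK.
  - by move=> i; exact: indic_int_shift.
  - rewrite -(indic_int_shift (xN y) r0) [LHS]integral_mkcond.
    apply: eq_integral => s _; rewrite patchE mem_setE in_itv/= andbT.
    case: ifPn => // s0; rewrite indicE mem_setE in_itv/=.
    by case: ltP => //= ys; move: s0; rewrite (lt_trans y0 ys).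
have box01 z : box z = 0 \/ (box z = 1 /\ enorm (sub_space y z) < Num.sqrt t).
  have [[hz1 hz2]|hz] := pselect ((forall i, tnth z.1 i \in `]tnth y.1 i, (tnth y.1 i + r)[)
    /\ xN z \in `]xN y, (xN y + r)[).
    right; split.
      rewrite /box big1 => [|i _]; last by rewrite indicE mem_setE hz1.
      by rewrite mul1r indicE mem_setE hz2.
    have sqr_lt (a b : R) : b \in `]a, (a + r)[ -> (a - b) ^+ 2 < r ^+ 2.
      rewrite in_itv/= => /andP[ab bar]; rewrite -sqrrN opprB.
      by apply: ltrXn2r => //; [rewrite subr_ge0 ltW|rewrite ltrBlDl].
    rewrite -(@ltr_pXn2r _ 2) ?nnegrE ?enorm_ge0 ?sqrtr_ge0// enormE sqr_sqrtr ?(ltW t0)//.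
    apply: (@le_lt_trans _ _ ((\sum_(i < N.-1) r ^+ 2) + (xN y - xN z) ^+ 2)).
      rewrite lerD2r; apply: ler_sum => i _; rewrite sub_spaceE.
      by apply/ltW/sqr_lt/hz1.
    apply: (@lt_le_trans _ _ ((\sum_(i < N.-1) r ^+ 2) + r ^+ 2)).
      by rewrite ltrD2l; exact: sqr_lt.
    rewrite sumr_const card_ord -mulrSr prednK// -mulr_natr.
    have -> : r ^+ 2 * N%:R = t / N%:R.
      by rewrite /r -[in RHS](sqr_sqrtr (ltW t0)); field; rewrite gt_eqF.
    by rewrite ler_pdivrMr// ler_peMr ?(ltW t0)// ler1n.
  left; apply/eqP; rewrite mulf_eq0; apply/orP.
  have [/existsP[i hi]|/existsPn h] :=
      boolP [exists i, tnth z.1 i \notin `]tnth y.1 i, (tnth y.1 i + r)[].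
    left; apply/prodf_eq0; exists i => //.
    by rewrite indicE mem_setE (negbTE hi).
  right; rewrite indicE mem_setE.
  case: (boolP (xN z \in _)) => // h2; exfalso; apply: hz; split => // i.
  by have := h i; rewrite negbK.
have box0 z : 0 <= box z by case: (box01 z) => [->|[->]].
have mbox : measurable_fun setT box.
  have mi (c' : R) : measurable_fun setT (\1_`]c', (c' + r)[ : R -> R).
    by apply: measurable_indic; exact: measurable_itv.
  apply: measurable_funM.
    apply: measurable_prod => i _.
    apply: (measurableT_comp (mi (tnth y.1 i))).
    by apply: (measurableT_comp (measurable_tnth i)).
  exact: (measurableT_comp (mi (xN y)) measurable_snd).
have key : ((r ^+ N * (c * g))%:E <=
   \int[lebX]_(z in ball_Omega y (Num.sqrt t)) (Gamma (sub_space x z) (4 * t))%:E)%E.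
  rewrite mulrC EFinM -boxr -ge0_integralZl_EFin//; last 4 first.
  - exact: measurable_Omega.
  - by move=> z _; rewrite lee_fin.
  - by apply/measurable_EFinP; exact: measurable_funTS.
  - by rewrite mulr_ge0 ?Gamma_ge0// ltW.
  rewrite integral_mkcond [leRHS]integral_mkcond.
  apply: ge0_le_integral => //.
  - move=> z _; apply: erestrict_ge0 => w _.
    by rewrite -EFinM lee_fin mulr_ge0 ?box0// mulr_ge0 ?Gamma_ge0 ?(ltW c0).
  - apply/(measurable_restrictT _ _).1; first exact: measurable_Omega.
    apply: measurable_funeM; apply/measurable_EFinP; exact: measurable_funTS.
  - apply/(measurable_restrictT _ _).1; first exact: measurable_ball_Omega.
    by apply: measurable_funTS; exact: measurable_EFin_Gamma.
  - move=> z _; rewrite !patchE; case: ifPn => [/set_mem zO|_]; last first.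
      by case: ifPn => // _; rewrite lee_fin Gamma_ge0.
    case: (box01 z) => [->|[-> yz]].
      by rewrite mule0; case: ifPn => // _; rewrite lee_fin Gamma_ge0.
    rewrite mule1 mem_set; last by split.
    by rewrite lee_fin; exact: Gamma_le_Gamma_ball.
have rE : r ^+ N = N%:R^-1 ^+ N * t `^ (N%:R / 2).
  rewrite /r exprMn mulrC; congr (_ * _).
  by rewrite -powR_mulrn ?sqrtr_ge0// -powR12_sqrt ?(ltW t0)// -powRrM mulrC.
have tN0 : 0 < t `^ (N%:R / 2) by rewrite powR_gt0.
rewrite powRN.
apply: le_trans (lee_wpmul2l _ key); last first.
  by rewrite lee_fin mulr_ge0 ?invr_ge0 ?powR_ge0// mulr_ge0 ?exprn_ge0 ?invr_ge0// ltW.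
rewrite -EFinM lee_fin rE le_eqVlt; apply/orP; left; apply/eqP.
rewrite -/g; field.
by rewrite expf_neq0 ?invr_eq0 ?gt_eqF// !gt_eqF.
Qed.


(** Replacing the Gaussian by its average and exchanging the integrals turns the weight
into its integrals over balls, without any covering of the half-space: what remains is
a Gaussian of mass at most 1. *)
Lemma heat_le_ball_sup (l : R) : 0 <= l <= 1 -> exists2 C : R, 0 < C &
  forall (H : X -> \bar R) (t A : R) x,
  measurable_fun setT H -> (forall y, 0 <= H y)%E -> 0 < t -> Omega x ->
  (forall z, Omega z ->
    \int[lebX]_(y in ball_Omega z (Num.sqrt t)) ((xN y `^ l)%:E * H y) <= A%:E)%E ->
  (heat t H x <= (C * t `^ (- ((N%:R + l) / 2)) * A)%:E)%E.
Proof.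
move=> hl; have [C1 C10 hC1] := Gamma_le_average.
have p2 : 0 < (2 : R) `^ (N%:R / 2) by rewrite powR_gt0.
exists (4 * 2 `^ (N%:R / 2) * C1); first by rewrite !mulr_gt0.
move=> H t A x mH H0 t0 xO hA.
pose J y : \bar R := ((xN y `^ l)%:E * H y)%E.
have J0 y : (0 <= J y)%E by rewrite mule_ge0// lee_fin powR_ge0.
have mJ : measurable_fun setT J.
  apply: emeasurable_funM => //; apply/measurable_EFinP.
  by apply: (measurableT_comp (measurable_powR _)); exact: measurable_xN_comp.
have mO := @measurable_Omega R N.
pose k1 : R := 4 * 2 `^ (N%:R / 2) * t `^ (- (l / 2)).
pose k2 : R := C1 * t `^ (- (N%:R / 2)).
have k10 : 0 <= k1 by rewrite !mulr_ge0// powR_ge0.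
have k20 : 0 <= k2 by rewrite mulr_ge0 ?powR_ge0// ltW.
pose S : set (X * X) := [set p | [/\ Omega p.1, Omega p.2 &
  enorm (sub_space p.1 p.2) < Num.sqrt t]].
have mS : measurable S.
  rewrite (_ : S = (Omega `*` Omega) `&`
     ((fun p : X * X => enorm (sub_space p.1 p.2)) @^-1` `]-oo, Num.sqrt t[%classic)).
    apply: measurableI; first exact: measurableX.
    rewrite -[X in measurable X]setTI; apply: measurable_enorm_sub_comp => //.
  apply/seteqP; split => p /=; rewrite in_itv/=.
    by case.
  by case=> -[].
pose psi (p : X * X) : \bar R := ((Gamma (sub_space x p.2) (4 * t))%:E * J p.1)%E.
have psi0 p : (0 <= psi p)%E by rewrite mule_ge0// lee_fin Gamma_ge0.
have mpsi : measurable_fun setT psi.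
  apply: emeasurable_funM; last exact: (measurableT_comp mJ).
  apply/measurable_EFinP; exact: measurable_Gamma_sub_comp.
pose phi := psi \_ S.
have phi0 p : (0 <= phi p)%E by apply: erestrict_ge0.
have mphi : measurable_fun setT phi.
  by apply/(measurable_restrictT _ _).1 => //; exact: measurable_funTS.
have mG s : measurable_fun setT (fun y => (Gamma (sub_space x y) s)%:E).
  exact: measurable_EFin_Gamma.
have G0 y s : (0 <= (Gamma (sub_space x y) s)%:E)%E by rewrite lee_fin Gamma_ge0.
have phi1 y : (\int[lebX]_z phi (y, z) = (fun y => J y *
    \int[lebX]_(z in ball_Omega y (Num.sqrt t)) (Gamma (sub_space x z) (4 * t))%:E)%E
    \_ Omega y)%E.
  rewrite patchE; case: ifPn => [/set_mem yO|/negP yO]; last first.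
    apply: integral0_eq => z _; rewrite /phi patchE; case: ifPn => // /set_mem[/= + _ _].
    by move/mem_set.
  rewrite -ge0_integralZl//; last 2 first.
  - exact: measurable_ball_Omega.
  - by apply: measurable_funTS; exact: mG.
  rewrite [RHS]integral_mkcond; apply: eq_integral => z _.
  rewrite /phi !patchE /psi/= muleC; congr (if _ then _ else _).
  by apply/idP/idP => /set_mem h; apply/mem_set; case: h.
have phi2 z : (\int[lebX]_y phi (y, z) = (fun z => (Gamma (sub_space x z) (4 * t))%:E *
    \int[lebX]_(y in ball_Omega z (Num.sqrt t)) J y)%E \_ Omega z)%E.
  rewrite patchE; case: ifPn => [/set_mem zO|/negP zO]; last first.
    apply: integral0_eq => y _; rewrite /phi patchE; case: ifPn => // /set_mem[/= _ + _].
    by move/mem_set.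
  rewrite -ge0_integralZl//; last 2 first.
  - exact: measurable_ball_Omega.
  - exact: measurable_funTS.
  rewrite [RHS]integral_mkcond; apply: eq_integral => y _.
  rewrite /phi !patchE /psi/=; congr (if _ then _ else _).
  apply/idP/idP => /set_mem h; apply/mem_set; case: h => //=.
    by move=> ? ? ?; split => //=; rewrite enorm_sub_spaceC.
  by move=> ? ?; split => //=; rewrite enorm_sub_spaceC.
have -> : 4 * 2 `^ (N%:R / 2) * C1 * t `^ (- ((N%:R + l) / 2)) * A =
    k1 * k2 * A.
  rewrite /k1 /k2.
  have -> : t `^ (- ((N%:R + l) / 2)) = t `^ (- (N%:R / 2)) * t `^ (- (l / 2)).
    rewrite -powRD; last by apply/implyP => _; rewrite gt_eqF.
    by congr (_ `^ _); field.
  ring.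
have mphi1 : measurable_fun setT (fun y => \int[lebX]_z phi (y, z))%E.
  exact: (measurable_fun_fubini_tonelli_F (m2 := lebX)).
have mphi2 : measurable_fun setT (fun z => \int[lebX]_y phi (y, z))%E.
  exact: (measurable_fun_fubini_tonelli_G (m1 := lebX)).
apply: (@le_trans _ _ ((k1 * k2)%:E * \int[lebX]_y \int[lebX]_z phi (y, z))%E).
  have <- := @ge0_integralZl_EFin _ _ _ lebX setT measurableT
    (fun y => \int[lebX]_z phi (y, z))%E
    (fun y _ => integral_ge0 _ (fun z _ => phi0 (y, z))) mphi1 _ (mulr_ge0 k10 k20).
  rewrite /heat [leLHS]integral_mkcond; apply: ge0_le_integral => //.
  - move=> y _; apply: erestrict_ge0 => w wO.
    by rewrite mule_ge0// lee_fin G_ge0// ltW.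
  - apply/(measurable_restrictT _ _).1 => //.
    by apply: emeasurable_funM; apply: measurable_funTS => //; exact: measurable_EFin_G.
  - exact: (measurable_funeM (k1 * k2)%:E mphi1).
  - move=> y _; rewrite phi1 !patchE; case: ifPn => [/set_mem yO|_]; last by rewrite mule0.
    have := G_le_weight hl t0 xO yO; rewrite -/k1 => hG.
    apply: (@le_trans _ _ ((k1 * (xN y `^ l * Gamma (sub_space x y) (2 * t)))%:E * H y)%E).
      by apply: lee_wpmul2r => //; rewrite lee_fin.
    have -> : ((k1 * (xN y `^ l * Gamma (sub_space x y) (2 * t)))%:E * H y =
      k1%:E * (J y * (Gamma (sub_space x y) (2 * t))%:E))%E.
      by rewrite /J (EFinM k1) (EFinM (xN y `^ l)) -!muleA (muleC (H y)).
    rewrite (EFinM k1 k2) -[leRHS]muleA; apply: lee_wpmul2l; first by rewrite lee_fin.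
    rewrite muleCA; apply: lee_wpmul2l => //.
    exact: hC1.
rewrite (fubini_tonelli phi)//.
rewrite (EFinM (k1 * k2)); apply: lee_wpmul2l; first by rewrite lee_fin mulr_ge0.
have hA0 z : Omega z -> (0 <= A%:E)%E.
  by move=> zO; apply: le_trans (hA z zO); apply: integral_ge0 => y _; exact: J0.
apply: (@le_trans _ _ (\int[lebX]_(z in Omega) (A%:E * (Gamma (sub_space x z) (4 * t))%:E))%E).
  rewrite [leRHS]integral_mkcond; apply: ge0_le_integral => //.
  - by move=> z _; apply: integral_ge0.
  - apply/(measurable_restrictT _ _).1 => //.
    by apply: measurable_funeM; apply: measurable_funTS.
  - move=> z _; rewrite phi2 !patchE; case: ifPn => // /set_mem zO.
    by rewrite muleC; apply: lee_wpmul2r => //; exact: hA.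
rewrite ge0_integralZl_EFin//.
- rewrite -[leRHS]mule1; apply: lee_wpmul2l; first exact: hA0 xO.
  by apply: integral_Gamma_Omega_le1 => //; exact: mulr_gt0.
- by apply: measurable_funTS.
- by have := hA0 x xO; rewrite lee_fin.
Qed.

End smoothing.

(** * The Duhamel operator *)

Section duhamel.
Context {R : realType} {N : nat}.
Hypothesis hN : (1 <= N)%N.
Local Notation X := (coord_space R N).
Local Notation mR := (measurableTypeR R).
Local Notation leb := (@lebesgue_measure R).
Local Notation lebX := (@lebesgue_space R N).
Local Open Scope ereal_scope.

Lemma measurable_restrictT_of d (T : measurableType d) (D : set T) (f : T -> \bar R) :
  measurable D -> measurable_fun setT f -> measurable_fun setT (f \_ D).
Proof. by move=> mD mf; apply/(measurable_restrictT _ _).1 => //; exact: measurable_funTS. Qed.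

Lemma measurable_QT (T : R) : measurable (@QT R N T).
Proof.
rewrite (_ : QT T = Omega `*` (`]0%R, T[%classic : set mR)).
  by apply: measurableX; [exact: measurable_Omega|exact: measurable_itv].
by apply/seteqP; split => z /=; rewrite /QT/= in_itv.
Qed.

Lemma measurable_heat_y (t : R) (x : X) (g : X -> \bar R) :
  measurable_fun setT g -> measurable_fun setT (fun y => (G x y t)%:E * g y).
Proof. by move=> mg; apply: emeasurable_funM => //; exact: measurable_EFin_G. Qed.

Lemma heat_ge0 (t : R) (g : X -> \bar R) (x : X) : (0 < t)%R -> Omega x ->
  (forall y, 0 <= g y) -> 0 <= heat t g x.
Proof.
move=> t0 xO g0; apply: integral_ge0 => y yO.
by rewrite mule_ge0// lee_fin G_ge0// ltW.
Qed.

Lemma measurable_heat (T : R) (g : X -> \bar R) :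
  measurable_fun setT g -> (forall y, 0 <= g y) ->
  measurable_fun (@QT R N T) (fun z => heat z.2 g z.1).
Proof.
move=> mg g0.
pose S : set ((X * mR) * X) := QT T `*` Omega.
have mS : measurable S.
  by apply: measurableX; [exact: measurable_QT|exact: measurable_Omega].
pose psi : (X * mR) * X -> \bar R :=
  (fun q => (G q.1.1 q.2 q.1.2)%:E * g q.2) \_ S.
have psi0 q : 0 <= psi q.
  apply: erestrict_ge0 => -[[x t] y] [[/= xO /andP[t0 _]] yO].
  by rewrite mule_ge0// lee_fin G_ge0// ltW.
have mpsi : measurable_fun setT psi.
  apply: measurable_restrictT_of => //; apply: emeasurable_funM.
    apply/measurable_EFinP; apply: measurable_G_comp => //.
      exact: (measurableT_comp measurable_fst).
    exact: (measurableT_comp measurable_snd).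
  exact: (measurableT_comp mg).
have mF := measurable_fun_fubini_tonelli_F (m2 := lebX) psi mpsi psi0.
apply: (eq_measurable_fun (fubini_F lebX psi)); last exact: measurable_funTS.
move=> z /set_mem zQ; rewrite /fubini_F /heat [RHS]integral_mkcond.
apply: eq_integral => y _; rewrite /psi !patchE.
congr (if _ then _ else _); apply/idP/idP => /set_mem h; apply/mem_set => //.
by case: h.
Qed.

Lemma heat_semigroup (a c : R) (g : X -> \bar R) (x : X) :
  (0 < a)%R -> (0 < c)%R -> Omega x ->
  measurable_fun setT g -> (forall y, 0 <= g y) ->
  heat a (heat c g) x = heat (a + c) g x.
Proof.
move=> a0 c0 xO mg g0.
have mO := @measurable_Omega R N.
pose S : set (X * X) := Omega `*` Omega.
have mS : measurable S by exact: measurableX.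
pose psi : X * X -> \bar R :=
  (fun q => (G x q.1 a * G q.1 q.2 c)%:E * g q.2) \_ S.
have psi0 q : 0 <= psi q.
  apply: erestrict_ge0 => -[y z] [/= yO zO].
  by rewrite mule_ge0// lee_fin mulr_ge0// G_ge0// ltW.
have mpsi : measurable_fun setT psi.
  apply: measurable_restrictT_of => //; apply: emeasurable_funM.
    apply/measurable_EFinP; apply: measurable_funM.
      by apply: measurable_G_comp.
    by apply: measurable_G_comp.
  exact: (measurableT_comp mg).
transitivity (\int[lebX]_y \int[lebX]_z psi (y, z)).
  rewrite /heat integral_mkcond; apply: eq_integral => y _.
  rewrite patchE; case: ifPn => [/set_mem yO|/negP yO]; last first.
    rewrite integral0_eq// => z _; rewrite /psi patchE.
    by case: ifPn => // /set_mem[/= + _] => /mem_set.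
  rewrite -ge0_integralZl_EFin//; last 3 first.
  - by move=> z zO; rewrite mule_ge0// lee_fin G_ge0// ltW.
  - by apply: measurable_funTS; exact: measurable_heat_y.
  - by rewrite G_ge0// ltW.
  rewrite integral_mkcond; apply: eq_integral => z _.
  rewrite /psi !patchE/= EFinM muleA.
  congr (if _ then _ else _); apply/idP/idP => /set_mem h; apply/mem_set => //.
  by case: h.
rewrite (fubini_tonelli psi)// /heat [RHS]integral_mkcond.
apply: eq_integral => z _; rewrite patchE.
case: ifPn => [/set_mem zO|/negP zO]; last first.
  rewrite integral0_eq// => y _; rewrite /psi patchE.
  by case: ifPn => // /set_mem[/= _ +] => /mem_set.
rewrite -(G_semigroup hN a0 c0 (ltW xO) (ltW zO)).
rewrite muleC -ge0_integralZl//; last 2 first.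
- apply: measurable_funTS; apply/measurable_EFinP; apply: measurable_funM.
    exact: measurable_G_comp.
  exact: measurable_G_comp.
- by move=> y yO; rewrite lee_fin mulr_ge0// G_ge0// ltW.
rewrite [RHS]integral_mkcond; apply: eq_integral => y _.
rewrite /psi !patchE/= muleC.
congr (if _ then _ else _); apply/idP/idP => /set_mem h; apply/mem_set => //.
by case: h.
Qed.

Definition duhamel (w : X * mR -> \bar R) (z : X * mR) : \bar R :=
  \int[leb]_(s in `]0%R, (z.2 : R)[)
    \int[lebX]_(y in Omega) ((G z.1 y (z.2 - s))%:E * w (y, s)).

Section duhamel_measurable.
Variables (w : X * mR -> \bar R).
Hypotheses (mw : measurable_fun setT w) (w0 : forall z, 0 <= w z).

Let S : set (((X * mR) * mR) * X) :=
  [set q | [/\ Omega q.1.1.1, Omega q.2, (0 < (q.1.2 : R))%R &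
               ((q.1.2 : R) < q.1.1.2)%R]].

Let mS : measurable S.
Proof.
have pOmega (f : ((X * mR) * mR) * X -> X) : measurable_fun setT f ->
    measurable (f @^-1` Omega).
  by move=> mf; rewrite -[X in measurable X]setTI; apply: mf => //; exact: measurable_Omega.
have plt (f : ((X * mR) * mR) * X -> R) : measurable_fun setT f ->
    measurable (f @^-1` `]0%R, +oo[%classic).
  by move=> mf; rewrite -[X in measurable X]setTI; apply: mf.
rewrite (_ : S = ((fun q => q.1.1.1) @^-1` Omega `&` (fun q => q.2) @^-1` Omega) `&`
   ((fun q => q.1.2) @^-1` `]0%R, +oo[%classic `&`
    (fun q => q.1.1.2 - q.1.2)%R @^-1` `]0%R, +oo[%classic)).
  apply: measurableI; apply: measurableI.
  - apply: pOmega; apply: (measurableT_comp measurable_fst).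
    exact: (measurableT_comp measurable_fst).
  - exact: (pOmega snd).
  - by apply: plt; exact: (measurableT_comp measurable_snd).
  - apply: plt; apply: measurable_funB.
      apply: (measurableT_comp measurable_snd).
      exact: (measurableT_comp measurable_fst).
    exact: (measurableT_comp measurable_snd).
apply/seteqP; split => q /=; rewrite /S/= !in_itv/= !andbT subr_gt0.
  by case.
by case=> -[? ?] [].
Qed.

Let psi : ((X * mR) * mR) * X -> \bar R :=
  (fun q => (G q.1.1.1 q.2 (q.1.1.2 - q.1.2))%:E * w (q.2, q.1.2)) \_ S.

Let psi0 q : 0 <= psi q.
Proof.
apply: erestrict_ge0 => -[[[x t] s] y] [/= xO yO s0 st].
by rewrite mule_ge0// lee_fin G_ge0 ?subr_gt0// ltW.
Qed.

Let mpsi : measurable_fun setT psi.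
Proof.
apply: measurable_restrictT_of => //; apply: emeasurable_funM.
  apply/measurable_EFinP; apply: measurable_G_comp => //.
    apply: (measurableT_comp measurable_fst).
    exact: (measurableT_comp measurable_fst).
  apply: measurable_funB.
    apply: (measurableT_comp measurable_snd).
    exact: (measurableT_comp measurable_fst).
  exact: (measurableT_comp measurable_snd).
have mp : measurable_fun setT (fun q : ((X * mR) * mR) * X => (q.2, q.1.2)).
  apply/measurable_fun_pairP; split; first exact: measurable_snd.
  exact: (measurableT_comp measurable_snd measurable_fst).
exact: (measurableT_comp mw mp).
Qed.

Let I : (X * mR) * mR -> \bar R := fubini_F lebX psi.

Let mI : measurable_fun setT I.
Proof. exact: measurable_fun_fubini_tonelli_F. Qed.

Let I0 q : 0 <= I q. Proof. by apply: integral_ge0. Qed.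

Let IE (z : X * mR) (s : mR) : Omega z.1 -> (0 < (s : R))%R -> ((s : R) < z.2)%R ->
  I (z, s) = \int[lebX]_(y in Omega) ((G z.1 y (z.2 - s))%:E * w (y, s)).
Proof.
move=> xO s0 st; rewrite /I /fubini_F [RHS]integral_mkcond.
apply: eq_integral => y _; rewrite /psi !patchE/=.
by congr (if _ then _ else _); apply/idP/idP => /set_mem h; apply/mem_set => //; case: h.
Qed.

Lemma measurable_duhamel_inner (z : X * mR) : Omega z.1 ->
  measurable_fun (`]0%R, (z.2 : R)[%classic : set mR)
    (fun s => \int[lebX]_(y in Omega) ((G z.1 y (z.2 - s))%:E * w (y, s))).
Proof.
move=> xO; apply: (eq_measurable_fun (fun s : mR => I (z, s))).
  by move=> s /set_mem/=; rewrite in_itv/= => /andP[s0 st]; rewrite IE.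
by apply: measurable_funTS; apply: (measurableT_comp mI).
Qed.

Lemma duhamel_inner_ge0 (z : X * mR) (s : mR) : Omega z.1 -> ((s : R) < z.2)%R ->
  0 <= \int[lebX]_(y in Omega) ((G z.1 y (z.2 - s))%:E * w (y, s)).
Proof.
move=> xO st; apply: integral_ge0 => y yO.
by rewrite mule_ge0// lee_fin G_ge0 ?subr_gt0// ltW.
Qed.

Lemma duhamel_ge0 (z : X * mR) : Omega z.1 -> 0 <= duhamel w z.
Proof.
move=> xO; apply: integral_ge0 => s /=; rewrite in_itv/= => /andP[_ st].
exact: duhamel_inner_ge0.
Qed.

Lemma measurable_duhamel (T : R) : measurable_fun (@QT R N T) (duhamel w).
Proof.
pose J : (X * mR) * mR -> \bar R :=
  I \_ [set q | (0 < (q.2 : R))%R /\ ((q.2 : R) < q.1.2)%R].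
have J0 q : 0 <= J q by apply: erestrict_ge0.
have mJ : measurable_fun setT J.
  apply: measurable_restrictT_of => //.
  have plt (f : (X * mR) * mR -> R) : measurable_fun setT f ->
      measurable (f @^-1` `]0%R, +oo[%classic).
    by move=> mf; rewrite -[X in measurable X]setTI; apply: mf.
  rewrite (_ : mkset _ = (fun q => q.2) @^-1` `]0%R, +oo[%classic `&`
    (fun q : (X * mR) * mR => (q.1.2 : R) - q.2)%R @^-1` `]0%R, +oo[%classic).
    apply: measurableI; first exact: (plt snd).
    by apply: plt; apply: measurable_funB => //; exact: (measurableT_comp measurable_snd).
  by apply/seteqP; split => q /=; rewrite !in_itv/= !andbT subr_gt0.
have mF := measurable_fun_fubini_tonelli_F (m2 := leb) J mJ J0.
apply: (eq_measurable_fun (fubini_F leb J)); last exact: measurable_funTS.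
move=> z /set_mem [zO _]; rewrite /fubini_F /duhamel [RHS]integral_mkcond.
apply: eq_integral => s _; rewrite /J !patchE mem_setE in_itv/=.
rewrite (_ : (_ \in _) = (0 < s < z.2)%R); last first.
  by apply/idP/idP => [/set_mem[/= -> ->]|/andP[? ?]] //; exact/mem_set.
by case: ifPn => // /andP[s0 st]; rewrite IE.
Qed.

End duhamel_measurable.

Lemma le_duhamel (T : R) (w w' : X * mR -> \bar R) (z : X * mR) :
  measurable_fun setT w -> (forall q, 0 <= w q) ->
  measurable_fun setT w' -> (forall q, 0 <= w' q) ->
  (forall q, QT T q -> w q <= w' q) -> QT T z -> duhamel w z <= duhamel w' z.
Proof.
move=> mw w0 mw' w'0 ww' [zO /andP[z0 zT]].
apply: ge0_le_integral => //.
- by move=> s /=; rewrite in_itv/= => /andP[_ st]; exact: duhamel_inner_ge0.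
- exact: measurable_duhamel_inner.
- exact: measurable_duhamel_inner.
- move=> s /=; rewrite in_itv/= => /andP[s0 st].
  have ms (v : X * mR -> \bar R) : measurable_fun setT v ->
      measurable_fun Omega (fun y => (G z.1 y (z.2 - s))%:E * v (y, s)).
    move=> mv; apply: measurable_funTS.
    by apply: (@measurable_heat_y _ _ (fun y => v (y, s))); apply: (measurableT_comp mv).
  apply: ge0_le_integral => //; first exact: measurable_Omega.
  + by move=> y yO; rewrite mule_ge0// lee_fin G_ge0 ?subr_gt0// ltW.
  + exact: ms.
  + exact: ms.
  + move=> y yO; apply: lee_wpmul2l; first by rewrite lee_fin G_ge0 ?subr_gt0// ltW.
    by apply: ww'; split => //=; rewrite s0/= (lt_trans st).
Qed.

(** By the semigroup property the inner integral at time s is at most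
phi(s) G(t - s) G(s) H = phi(s) G(t) H. *)
Lemma duhamel_le_heat (T : R) (w : X * mR -> \bar R) (H : X -> \bar R)
    (phi : R -> R) (z : X * mR) :
  measurable_fun setT w -> (forall q, 0 <= w q) ->
  measurable_fun setT H -> (forall y, 0 <= H y) ->
  measurable_fun setT phi -> (forall s, (0 < s)%R -> (0 <= phi s)%R) ->
  QT T z ->
  (forall q, QT T q -> w q <= (phi q.2)%:E * heat q.2 H q.1) ->
  duhamel w z <= heat z.2 H z.1 * \int[leb]_(s in `]0%R, (z.2 : R)[) (phi s)%:E.
Proof.
move=> mw w0 mH H0 mphi phi0 [zO /andP[z0 zT]] wle.
have mO := @measurable_Omega R N.
have QTs (s : mR) (y : X) : (0 < (s : R))%R -> ((s : R) < z.2)%R -> Omega y -> QT T (y, s).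
  by move=> s0 st yO; split => //=; rewrite s0/= (lt_trans st).
have inner (s : mR) : (0 < (s : R))%R -> ((s : R) < z.2)%R ->
    \int[lebX]_(y in Omega) ((G z.1 y (z.2 - s))%:E * w (y, s)) <=
    heat z.2 H z.1 * (phi s)%:E.
  move=> s0 st; have st0 : (0 < (z.2 : R) - s)%R by rewrite subr_gt0.
  have G0 y : Omega y -> 0 <= (G z.1 y (z.2 - s))%:E.
    by move=> yO; rewrite lee_fin G_ge0// ltW.
  have mG : measurable_fun Omega (fun y : X => (G z.1 y (z.2 - s))%:E).
    by apply: measurable_funTS; exact: measurable_EFin_G.
  have mh : measurable_fun Omega (heat s H).
    apply: (@measurable_comp _ _ _ _ _ _ (QT T) (fun q => heat q.2 H q.1) _
      (fun y : X => (y, s))).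
    - exact: measurable_QT.
    - by move=> _ [y yO <-]; exact: QTs.
    - exact: measurable_heat.
    - by apply: measurable_funTS; exact: pair2_measurable.
  have h0 y : Omega y -> 0 <= heat s H y by move=> yO; exact: heat_ge0.
  rewrite muleC -(subrK (s : R) z.2) -(heat_semigroup st0 s0 zO mH H0) addrK.
  rewrite /heat -/(heat s H) -ge0_integralZl_EFin//; last 3 first.
  - by move=> y yO; rewrite mule_ge0 ?G0 ?h0.
  - exact: emeasurable_funM.
  - exact: phi0.
  apply: ge0_le_integral => //.
  - by move=> y yO; rewrite mule_ge0// G0.
  - apply: emeasurable_funM => //; apply: measurable_funTS.
    by apply: (measurableT_comp mw); exact: pair2_measurable.
  - by apply: measurable_funeM; exact: emeasurable_funM.
  - move=> y yO; rewrite muleCA; apply: lee_wpmul2l; first exact: G0.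
    exact: (wle (y, s) (QTs s y s0 st yO)).
have mph : measurable_fun (`]0%R, (z.2 : R)[%classic : set mR) (fun s => (phi s)%:E).
  by apply/measurable_EFinP; exact: measurable_funTS.
have W0 : 0 <= heat z.2 H z.1 by exact: heat_ge0.
rewrite -ge0_integralZl//; last first.
  by move=> s /=; rewrite in_itv/= => /andP[s0 _]; rewrite lee_fin phi0.
apply: ge0_le_integral => //.
- by move=> s /=; rewrite in_itv/= => /andP[_ st]; exact: duhamel_inner_ge0.
- exact: measurable_duhamel_inner.
- exact: measurable_funeM.
- by move=> s /=; rewrite in_itv/= => /andP[s0 st]; exact: inner.
Qed.

(** Monotone convergence, once in y and once in s. *)
Lemma cvg_duhamel (T : R) (w : nat -> X * mR -> \bar R) (wl : X * mR -> \bar R)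
    (z : X * mR) :
  (forall n, measurable_fun setT (w n)) -> (forall n q, 0 <= w n q) ->
  (forall q, QT T q -> {homo w^~ q : m n / (m <= n)%N >-> m <= n}) ->
  (forall q, QT T q -> w n q @[n --> \oo] --> wl q) -> QT T z ->
  duhamel (w n) z @[n --> \oo] --> duhamel wl z.
Proof.
move=> mw w0 ndw wwl [zO /andP[z0 zT]].
pose I (v : X * mR -> \bar R) (s : mR) :=
  \int[lebX]_(y in Omega) ((G z.1 y (z.2 - s))%:E * v (y, s)).
have QTs (s : R) y : (0 < s)%R -> (s < z.2)%R -> Omega y -> QT T (y, s).
  by move=> s0 st yO; split => //=; rewrite s0/= (lt_trans st).
have G0 (s : R) y : (s < z.2)%R -> Omega y -> 0 <= (G z.1 y (z.2 - s))%:E.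
  by move=> st yO; rewrite lee_fin G_ge0 ?subr_gt0// ltW.
have ms (v : X * mR -> \bar R) (s : mR) : measurable_fun setT v ->
    measurable_fun Omega (fun y => (G z.1 y (z.2 - s))%:E * v (y, s)).
  move=> mv; apply: measurable_funTS.
  by apply: (@measurable_heat_y _ _ (fun y => v (y, s))); apply: (measurableT_comp mv).
have ndI (s : mR) : (0 < (s : R))%R -> ((s : R) < z.2)%R ->
    {homo (fun n => I (w n) s) : m n / (m <= n)%N >-> m <= n}.
  move=> s0 st m n mn; apply: ge0_le_integral => //; first exact: measurable_Omega.
  - by move=> y yO; rewrite mule_ge0// G0.
  - exact: ms.
  - exact: ms.
  - move=> y yO; apply: lee_wpmul2l; first exact: G0.
    by apply: ndw => //; exact: QTs.
have cvI (s : mR) : (0 < (s : R))%R -> ((s : R) < z.2)%R ->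
    I (w n) s @[n --> \oo] --> I wl s.
  move=> s0 st.
  rewrite (_ : I wl s = \int[lebX]_(y in Omega)
      limn (fun n => (G z.1 y (z.2 - s))%:E * w n (y, s))).
    apply: cvg_monotone_convergence.
    - exact: measurable_Omega.
    - by move=> n; exact: ms.
    - by move=> n y yO; rewrite mule_ge0// G0.
    - move=> y yO m n mn; apply: lee_wpmul2l; first exact: G0.
      by apply: ndw => //; exact: QTs.
  apply: eq_integral => y /set_mem yO; apply/esym/cvg_lim => //.
  by apply: cvgeZl => //; apply: wwl; exact: QTs.
rewrite (_ : duhamel wl z = \int[leb]_(s in `]0%R, (z.2 : R)[) limn (fun n => I (w n) s)).
  apply: cvg_monotone_convergence => //.
  - by move=> n; exact: measurable_duhamel_inner.
  - by move=> n s /=; rewrite in_itv/= => /andP[_ st]; exact: duhamel_inner_ge0.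
  - by move=> s /=; rewrite in_itv/= => /andP[s0 st]; exact: ndI.
apply: eq_integral => s /set_mem/=; rewrite in_itv/= => /andP[s0 st].
by apply/esym/cvg_lim => //; exact: cvI.
Qed.

End duhamel.

(** * Monotone iteration below a supersolution *)

Section iteration.
Context {R : realType} {N : nat}.
Hypothesis hN : (1 <= N)%N.
Local Notation X := (coord_space R N).
Local Notation mR := (measurableTypeR R).
Local Open Scope ereal_scope.

Lemma nondecreasing_cvg_poweR (p : R) (a : nat -> \bar R) (l : \bar R) :
  (0 < p)%R -> (forall n, 0 <= a n) -> {homo a : m n / (m <= n)%N >-> m <= n} ->
  l < +oo -> a n @[n --> \oo] --> l -> a n `^ p @[n --> \oo] --> l `^ p.
Proof.
move=> p0 a0 nda loo al.
have al' n : a n <= l.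
  rewrite -(cvg_lim _ al)//; apply: lime_ge; first by apply/cvg_ex; exists l.
  by exists n => // m /= nm; exact: nda.
have l0 : 0 <= l by exact: le_trans (a0 0%N) (al' 0%N).
have lf : l \is a fin_num by rewrite ge0_fin_numE.
have af n : a n \is a fin_num.
  by rewrite ge0_fin_numE//; exact: le_lt_trans (al' n) loo.
move: l0; rewrite le_eqVlt => /predU1P[l0|l0].
  rewrite -l0 poweR0r ?gt_eqF// (_ : (fun _ => _) = cst 0); first exact: cvg_cst.
  apply/funext => n /=; rewrite (_ : a n = 0) ?poweR0r ?gt_eqF//.
  by apply/eqP; rewrite eq_le a0 andbT l0.
have fl0 : (0 < fine l)%R by rewrite fine_gt0// l0.
rewrite -(fineK lf) poweR_EFin.
rewrite (_ : (fun n => _) = (fun n => (fine (a n) `^ p)%:E)); last first.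
  by apply/funext => n; rewrite -{1}(fineK (af n)) poweR_EFin.
apply: cvg_EFin; first by apply: nearW.
rewrite (_ : fine \o _ = (fun x : R => x `^ p)%R \o (fine \o a)); last by [].
apply: continuous_cvg.
  by apply/differentiable_continuous/derivable1_diffP/derivable_powR; rewrite in_itv/= fl0.
by apply: fine_cvg; rewrite fineK.
Qed.

(** B is a supersolution in the sense of the last hypothesis: the map
w |-> A + duhamel (w^p) preserves the functions below B.  Its iterates from 0 increase,
stay below B, and their limit is a fixed point by monotone convergence. *)
Lemma supersolution_iteration (T p : R) (A B : X * mR -> \bar R) :
  (0 < p)%R ->
  measurable_fun (QT T) A -> (forall z, QT T z -> 0 <= A z) ->
  (forall z, QT T z -> 0 <= B z) -> (forall z, QT T z -> B z < +oo) ->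
  (forall w : X * mR -> \bar R, measurable_fun setT w -> (forall z, 0 <= w z) ->
    (forall z, QT T z -> w z <= B z) ->
    forall z, QT T z -> A z + duhamel (fun q => w q `^ p) z <= B z) ->
  exists u : X * mR -> \bar R,
  [/\ measurable_fun (QT T) u, (forall z, QT T z -> 0 <= u z),
      (forall z, QT T z -> u z <= B z) &
      (forall z, QT T z -> u z = A z + duhamel (fun q => u q `^ p) z)].
Proof.
move=> p0 mA A0 B0 Boo HB.
have mQ := @measurable_QT R N T.
pose step (w : X * mR -> \bar R) := (fun z => A z + duhamel (fun q => w q `^ p) z) \_ (QT T).
pose u n := iter n step (cst 0).
have mp (w : X * mR -> \bar R) : measurable_fun setT w ->
    measurable_fun setT (fun q => w q `^ p).
  by move=> mw; apply: (measurableT_comp (measurable_poweR p)).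
have mstep w : measurable_fun setT w -> (forall z, 0 <= w z) -> measurable_fun setT (step w).
  move=> mw w0; apply/(measurable_restrictT _ _).1 => //.
  apply: emeasurable_funD => //; apply: measurable_duhamel; first exact: mp.
  by move=> z; exact: poweR_ge0.
have step0 w : (forall z, 0 <= w z) -> forall z, 0 <= step w z.
  move=> w0 z; apply: erestrict_ge0 => q qQ; rewrite adde_ge0// ?A0//.
  by apply: duhamel_ge0; [move=> ?; exact: poweR_ge0|case: qQ].
have stepE w z : QT T z -> step w z = A z + duhamel (fun q => w q `^ p) z.
  by move=> zQ; rewrite /step patchE mem_set.
have mu0 n : measurable_fun setT (u n) /\ forall z, 0 <= u n z.
  elim: n => [|n [mn n0]]; first by split => //; exact: measurable_cst.
  by split; [exact: mstep|exact: step0].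
have mu n := (mu0 n).1; have u0 n := (mu0 n).2.
have lestep w w' z : measurable_fun setT w -> (forall z, 0 <= w z) ->
    measurable_fun setT w' -> (forall z, 0 <= w' z) ->
    (forall z, QT T z -> w z <= w' z) -> QT T z -> step w z <= step w' z.
  move=> mw w0 mw' w'0 ww' zQ; rewrite (stepE w z zQ) (stepE w' z zQ); apply: leeD2l.
  apply: (@le_duhamel R N T) => //; try exact: mp.
  - by move=> q; exact: poweR_ge0.
  - by move=> q; exact: poweR_ge0.
  - move=> q qQ; apply: gt0_ler_poweR; rewrite ?in_itv/= ?leey ?andbT//; first exact: ltW.
    exact: ww'.
have uS n z : QT T z -> u n z <= u n.+1 z.
  elim: n z => [|n ih] z zQ; first exact: u0.
  exact: (lestep (u n) (u n.+1) z (mu n) (u0 n) (mu n.+1) (u0 n.+1) ih zQ).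
have ndu z : QT T z -> {homo u^~ z : m n / (m <= n)%N >-> m <= n}.
  by move=> zQ; apply: homo_leq => //; [move=> ? ? ?; exact: le_trans|move=> n; exact: uS].
have uB n z : QT T z -> u n z <= B z.
  by elim: n z => [|n ih] z zQ; [exact: B0|rewrite /= stepE//; exact: HB].
pose ul z := limn (u^~ z).
have cvu z : QT T z -> u n z @[n --> \oo] --> ul z.
  by move=> zQ; apply: ereal_nondecreasing_is_cvgn => m n mn; exact: ndu.
have ulB z : QT T z -> ul z <= B z.
  move=> zQ; apply: lime_le; first by apply/cvg_ex; exists (ul z); exact: cvu.
  by apply: nearW => n; exact: uB.
exists ul; split => //.
- apply: (emeasurable_fun_cvg u) => //; last by move=> n; exact: measurable_funTS.
- move=> z zQ; apply: lime_ge; first by apply/cvg_ex; exists (ul z); exact: cvu.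
  by apply: nearW => n; exact: u0.
- move=> z zQ.
  have c1 : u n.+1 z @[n --> \oo] --> ul z by have := cvu z zQ; rewrite -cvg_shiftS.
  have c2 : u n.+1 z @[n --> \oo] --> A z + duhamel (fun q => ul q `^ p) z.
    rewrite (_ : (fun n => _) = (fun n => A z + duhamel (fun q => u n q `^ p) z)); last first.
      by apply/funext => n; rewrite /= stepE.
    apply: cvgeD; [|exact: cvg_cst|].
      apply: ge0_adde_def; rewrite inE ?A0//.
      by apply: duhamel_ge0; [move=> ?; exact: poweR_ge0|case: zQ].
    apply: (@cvg_duhamel R N T (fun n q => u n q `^ p)) => //.
    + by move=> n; exact: mp.
    + by move=> n q; exact: poweR_ge0.
    + move=> q qQ m n mn; apply: gt0_ler_poweR; rewrite ?in_itv/= ?leey ?andbT//.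
        exact: ltW.
      exact: ndu.
    + move=> q qQ; apply: nondecreasing_cvg_poweR => //.
      * exact: ndu.
      * exact: le_lt_trans (ulB q qQ) (Boo q qQ).
      * exact: cvu.
  by rewrite -(cvg_lim _ c1)// -(cvg_lim _ c2).
Qed.

End iteration.

(** * Initial data *)

Section initial_data.
Context {R : realType} {N : nat}.
Local Notation X := (coord_space R N).
Local Notation mR := (measurableTypeR R).
Local Notation leb := (@lebesgue_measure R).
Local Notation lebX := (@lebesgue_space R N).
Local Open Scope ereal_scope.

Lemma inL_borel (f : X -> \bar R) : inL f -> exists g : X -> \bar R,
  [/\ measurable_fun setT g, (forall y, 0 <= g y),
      (forall y, ~ Omega y -> g y = 0) & f = g %[ae lebX in Omega]].
Proof.
move=> [f0 [h mh fh]].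
exists ((fun y => maxe (h y) 0) \_ Omega); split.
- apply/(measurable_restrictT _ _).1; first exact: measurable_Omega.
  exact: measurable_maxe.
- by move=> y; apply: erestrict_ge0 => z _; rewrite le_max lexx orbT.
- by move=> y yO; rewrite patchE; case: ifPn => // /set_mem.
- apply: filterS fh => y fhy yO.
  by rewrite patchE mem_set// -fhy// max_l// f0.
Qed.

Lemma negligible_boundary : lebX.-negligible [set y : X | xN y = 0%R].
Proof.
exists [set y : X | xN y = 0%R]; split => //.
  rewrite (_ : mkset _ = setT `*` [set 0%R : mR]).
    by apply: measurableX => //; exact: measurable_set1.
  by apply/seteqP; split => y /=; [|case].
rewrite (_ : mkset _ = setT `*` [set 0%R : mR]); last first.
  by apply/seteqP; split => y /=; [|case].
transitivity (lebesgue_tuple R N.-1 setT * leb [set 0%R : mR]).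
  by apply: product_measure1E => //; exact: measurable_set1.
by rewrite lebesgue_measure_set1 mule0.
Qed.

(** Inside the half-space the factor 1 / y_N of K cancels the weight y_N of the measure,
and the measure does not charge the boundary, where K is given by a derivative. *)
Lemma xN_density_integral_K (f g : X -> \bar R) (fL : inL f) (x : X) (t : R) :
  measurable_fun setT g -> (forall y, 0 <= g y) ->
  (forall y, ~ Omega y -> g y = 0) -> f = g %[ae lebX in Omega] ->
  Omega x -> (0 < t)%R ->
  \int[xN_density fL]_(y in Omegabar) (K x y t)%:E = heat t g x.
Proof.
move=> mg g0 gO fg xO t0.
have mxN : measurable_fun setT (@xN R N) by exact: measurable_snd.
pose h (y : X) : \bar R := (xN y)%:E * g y.
have hO y : ~ Omega y -> h y = 0 by move=> yO; rewrite /h gO// mule0.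
have mh : measurable_fun setT h.
  by apply: emeasurable_funM => //; exact/measurable_EFinP.
have h0 y : 0 <= h y.
  have [yO|yO] := pselect (Omega y); last by rewrite hO.
  by rewrite mule_ge0// lee_fin ltW.
have nuE A : measurable A -> xN_density fL A = \int[lebX]_(y in A) h y.
  move=> mA; rewrite /xN_density.
  transitivity (\int[lebX]_(y in A `&` Omega) h y).
    apply: integral_ae_eq_class; apply: filterS fg => y fgy [_ yO].
    by rewrite /h fgy.
  rewrite integral_mkcond [RHS]integral_mkcond; apply: eq_integral => y _.
  rewrite !patchE in_setI; case: (y \in A) => //=.
  by case: ifPn => // /negP yO; rewrite hO// => /mem_set.
have mOb := @measurable_Omegabar R N.
pose kf : X -> \bar R := (fun y => (K x y t)%:E) \_ Omegabar.
have K0 y : Omegabar y -> (0 <= K x y t)%R.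
  move=> y0; rewrite /K; case: ifPn => _.
    by rewrite mulr_ge0 ?invr_ge0// G_ge0// ltW.
  by rewrite mulr_ge0 ?Gamma_ge0// divr_ge0// ltW.
have kf0 y : 0 <= kf y by apply: erestrict_ge0 => z /K0; rewrite lee_fin.
have mkf : measurable_fun setT kf.
  apply: measurable_restrictT_of => //; apply/measurable_EFinP.
  rewrite /K; apply: measurable_fun_ifT => //.
  - by apply: measurable_fun_ltr.
  - apply: measurable_funM; first exact: (measurableT_comp measurable_invr).
    by apply: measurable_G_comp.
  - by apply: measurable_funM => //; apply: measurable_Gamma_sub_comp.
rewrite integral_mkcond -/kf (ge0_integral_density mh h0 nuE mkf kf0).
rewrite /heat [RHS]integral_mkcond; apply: eq_integral => y _.
rewrite patchE; case: ifPn => [/set_mem yO|/negP yO]; last first.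
  by rewrite hO ?mule0// => /mem_set.
rewrite /kf patchE mem_set; last exact: ltW.
rewrite /K /h; have -> : (0 < xN y)%R by [].
rewrite muleA -EFinM mulrAC mulVf ?mul1r//.
by rewrite gt_eqF.
Qed.

Lemma measurable_BOmega (x : X) (r : R) : measurable (BOmega x r).
Proof.
apply: measurableI.
  rewrite -[X in measurable X]setTI.
  have mf : measurable_fun setT (fun z : X => enorm (sub_space z x)).
    exact: measurable_enorm_sub_comp.
  have := mf measurableT `]-oo, r[%classic (measurable_itv _).
  by congr (measurable (_ `&` _)); apply/seteqP; split => z /=; rewrite in_itv.
exact: measurable_Omegabar.
Qed.

(** Transfers the hypothesis from f, of which only the almost everywhere class in the
half-space is controlled, to a Borel representative: the part of [BOmega] on the
boundary is a null set. *)
Lemma le_integral_BOmega (l b c r M : R) (f g : X -> \bar R) (z : X) :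
  (0 < b)%R -> (0 < c)%R ->
  measurable_fun setT g -> (forall y, 0 <= g y) ->
  (forall y, ~ Omega y -> g y = 0) -> f = g %[ae lebX in Omega] ->
  Omega z ->
  ereal_sup [set \int[lebX]_(y in BOmega x r)
      ((xN y `^ l)%:E * Phi b (c%:E * f y)) | x in Omegabar] <= M%:E ->
  \int[lebX]_(y in ball_Omega z r) ((xN y `^ l)%:E * Phi b (c%:E * g y)) <= M%:E.
Proof.
move=> b0 c0 mg g0 gO fg zO hM.
have cg0 y : 0 <= c%:E * g y by rewrite mule_ge0// lee_fin ltW.
pose J y := (xN y `^ l)%:E * Phi b (c%:E * g y).
have J0 y : 0 <= J y by rewrite mule_ge0 ?lee_fin ?powR_ge0// Phi_ge0.
have mJ : measurable_fun setT J.
  apply: emeasurable_funM.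
    apply/measurable_EFinP; apply: (measurableT_comp (measurable_powR _)).
    exact: measurable_snd.
  by apply: measurable_Phi_comp => //; exact: measurable_funeM.
apply: (@le_trans _ _ (\int[lebX]_(y in BOmega z r) J y)).
  apply: ge0_subset_integral => //.
  - exact: measurable_ball_Omega.
  - exact: measurable_BOmega.
  - exact: measurable_funTS.
  - by move=> y _; exact: J0.
  - move=> y [yO yz]; split; last exact: ltW.
    by rewrite /= enorm_sub_spaceC.
apply: le_trans hM; apply: ereal_sup_ubound; exists z; first exact: ltW.
apply: integral_ae_eq_class.
have nb := negligible_boundary.
rewrite (_ : [set y : X | xN y = 0%R] = ~` [set y : X | xN y <> 0%R]) in nb; last first.
  by apply/seteqP; split => y /=; [move=> -> ; apply|move/contrapT].
apply: filterS2 fg nb => y fgy y0 [_ yOb].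
rewrite /J fgy//; rewrite /Omega/= lt_neqAle yOb andbT eq_sym; exact/eqP.
Qed.

End initial_data.

(** * Comparing the linear flows of f and of Phi f *)

Section linear_flow.
Context {R : realType} {N : nat}.
Hypothesis hN : (1 <= N)%N.
Local Notation X := (coord_space R N).
Local Notation lebX := (@lebesgue_space R N).
Local Open Scope ereal_scope.

(** Either x <= v, or Phi(x) = x [ln (e + x)]^b >= x [ln (e + v)]^b. *)
Lemma le_add_Phi (b v : R) (x : \bar R) : (0 < b)%R -> (0 <= v)%R -> 0 <= x ->
  x <= v%:E + ((ln (expR 1 + v) `^ b)^-1)%:E * Phi b x.
Proof.
move=> b0 v0; have lv := @ln_expR1D_ge1 R v v0.
have lvb : (0 < ln (expR 1 + v) `^ b)%R by rewrite powR_gt0// (lt_le_trans _ lv).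
case: x => [r| |] //; last first.
  by move=> _; rewrite Phiy// gt0_muley ?lte_fin ?invr_gt0// addey.
rewrite lee_fin => r0; rewrite Phi_EFin// -EFinM -EFinD lee_fin.
have [rv|vr] := leP r v.
  apply: (le_trans rv); rewrite lerDl mulr_ge0 ?invr_ge0 ?(ltW lvb)//.
  by rewrite mulr_ge0// powR_ge0.
apply: ler_wpDl => //; rewrite mulrC ler_pdivlMr//.
apply: ler_wpM2l => //; apply: ler_powRl; [exact: ltW|exact: le_trans lv|].
exact: ler_ln_expR1D (ltW vr).
Qed.

(** Jensen's inequality for Phi up to a factor 2: [le_add_Phi] is integrated with v
chosen as the value of Phi^-1 at the integral of Phi, so that both terms contribute
v. *)
Lemma heat_le_of_heat_Phi (b c v t : R) (g : X -> \bar R) (x : X) :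
  (0 < b)%R -> (0 < c)%R -> (0 <= v)%R -> (0 < t)%R -> Omega x ->
  measurable_fun setT g -> (forall y, 0 <= g y) ->
  heat t (fun y => Phi b (c%:E * g y)) x = (v * ln (expR 1 + v) `^ b)%:E ->
  heat t g x <= (2 / c * v)%:E.
Proof.
move=> b0 c0 v0 t0 xO mg g0 hw.
have lv := @ln_expR1D_ge1 R v v0.
have lvb : (0 < ln (expR 1 + v) `^ b)%R by rewrite powR_gt0// (lt_le_trans _ lv).
have mO := @measurable_Omega R N.
pose H y := Phi b (c%:E * g y).
have cg0 y : 0 <= c%:E * g y by rewrite mule_ge0// lee_fin ltW.
have H0 y : 0 <= H y by exact: Phi_ge0.
have mH : measurable_fun setT H by apply: measurable_Phi_comp => //; exact: measurable_funeM.
pose ka := ((ln (expR 1 + v) `^ b)^-1)%R.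
have ka0 : (0 < ka)%R by rewrite invr_gt0.
have G0 y : Omega y -> 0 <= (G x y t)%:E by move=> yO; rewrite lee_fin G_ge0// ltW.
have mG : measurable_fun Omega (fun y => (G x y t)%:E).
  by apply: measurable_funTS; exact: measurable_EFin_G.
have mGH : measurable_fun Omega (fun y => (G x y t)%:E * H y).
  by apply: measurable_funTS; exact: measurable_heat_y.
rewrite -[leLHS]mul1e -(_ : (c^-1)%:E * c%:E = 1); last first.
  by rewrite -EFinM mulVf// gt_eqF.
rewrite (_ : (2 / c * v)%:E = (c^-1)%:E * (2 * v)%:E); last first.
  by rewrite -EFinM; congr EFin; ring.
rewrite -muleA; apply: lee_wpmul2l; first by rewrite lee_fin invr_ge0 ltW.
rewrite /heat -ge0_integralZl_EFin//; last 3 first.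
- by move=> y yO; rewrite mule_ge0// G0.
- by apply: measurable_funTS; exact: measurable_heat_y.
- exact: ltW.
apply: (@le_trans _ _ (\int[lebX]_(y in Omega) (v%:E * (G x y t)%:E +
   ka%:E * ((G x y t)%:E * H y)))).
  apply: ge0_le_integral => //.
  - by move=> y yO; rewrite !mule_ge0// ?G0// lee_fin ltW.
  - by apply: measurable_funeM; apply: measurable_funTS; exact: measurable_heat_y.
  - by apply: emeasurable_funD; apply: measurable_funeM.
  - move=> y yO; rewrite muleCA.
    apply: (@le_trans _ _ ((G x y t)%:E * (v%:E + ka%:E * H y))).
      by apply: lee_wpmul2l; [exact: G0|exact: le_add_Phi].
    rewrite ge0_muleDr; [|by rewrite lee_fin|by rewrite mule_ge0// lee_fin ltW].
    by rewrite [v%:E * _]muleC [ka%:E * (_ * _)]muleCA.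
rewrite ge0_integralD//; last 4 first.
- by move=> y yO; rewrite mule_ge0// ?G0.
- exact: measurable_funeM.
- by move=> y yO; rewrite mule_ge0 ?lee_fin ?(ltW ka0)// mule_ge0 ?G0.
- exact: measurable_funeM.
rewrite ge0_integralZl_EFin// ge0_integralZl_EFin//; last 2 first.
- by move=> y yO; rewrite mule_ge0// G0.
- exact: ltW.
have -> : \int[lebX]_(y in Omega) ((G x y t)%:E * H y) =
    (v * ln (expR 1 + v) `^ b)%:E by exact: hw.
rewrite -EFinM /ka mulrCA mulVf ?gt_eqF// mulr1 mulrDl mul1r EFinD.
apply: leeD2r; rewrite -[leRHS]mule1; apply: lee_wpmul2l; first by rewrite lee_fin.
exact: (integral_G_le1 hN t0 (ltW xO)).
Qed.

End linear_flow.

(** * Existence in the critical case *)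

Theorem theorem5p4 (R : realType) (N : nat) (l p b T : R) (hN : (1 <= N)%N)
    (hl : 0 <= l <= 1) (hp : p = 1 + 2 / (N%:R + l)) (hb : 0 < b)
    (hT : 0 < T) :
  exists2 gamma : R, 0 < gamma &
  forall (f : coord_space R N -> \bar R) (fL : inL f),
    (forall s : R, 0 < s < Num.sqrt T ->
      (ereal_sup [set \int[lebesgue_space]_(y in BOmega x s)
                        ((xN y `^ l)%:E * Phi b ((T `^ (1 / (p - 1)))%:E * f y))
                 | x in Omegabar]
       <= (gamma * T `^ ((N%:R + l) / 2)
           * ln (expR 1 + Num.sqrt T / s) `^ (b - (N%:R + l) / 2))%:E)%E) ->
    exists u : coord_space R N * measurableTypeR R -> \bar R,
      is_solution T p (xN_density fL) u /\
      exists2 C : R, 0 < C &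
        {ae lebesgue_spacetime, forall z, QT T z ->
          (0 <= u z /\
           u z <= C%:E * Phi_inv b
             (heat z.2 (fun y => Phi b ((T `^ (1 / (p - 1)))%:E * f y)) z.1))%E}.
Proof.
pose k : R := (N%:R + l) / 2.
have N1 : 1 <= N%:R :> R by rewrite ler1n.
have k0 : 0 < k by rewrite divr_gt0//; case/andP: hl => ? ?; lra.
have ki0 : 0 < k^-1 by rewrite invr_gt0.
have kip : p = 1 + k^-1 by rewrite hp /k invf_div.
have pk : 1 / (p - 1) = k by rewrite kip addrC addKr div1r invrK.
have p0 : 0 < p by rewrite kip addr_gt0.
rewrite pk -/k; pose c : R := T `^ k; rewrite -/c.
have c0 : 0 < c by rewrite powR_gt0.
have [Cs Cs0 hCs] := @heat_le_ball_sup R N hN l hl.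
have [C0 C00 hC0] := critical_profile_estimates k0 hb.
have [Ci Ci0 hCi] := @integral_logscale R T b hb.
(* A bounds the constants of the Duhamel term; d makes A d^(1 / (2 k)) at most 2, and
   gamma = eta / Cs turns the hypothesis into the one of the profile estimates. *)
pose A : R := 4 `^ p * C0 * Ci * C0.
have A0 : 0 < A by rewrite !mulr_gt0// powR_gt0.
have [d d01 hd] := exists_small_powR A0 (divr_gt0 ki0 (ltr0n R 2)).
have [eta eta0 heta] := hC0 d d01.
exists (eta / Cs); first exact: divr_gt0.
move=> f fL hf.
have [g [mg g0 gO fg]] := inL_borel fL.
pose H y := Phi b (c%:E * g y)%E.
have cg0 y : (0 <= c%:E * g y)%E by rewrite mule_ge0// lee_fin ltW.
have H0 y : (0 <= H y)%E by exact: Phi_ge0.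
have mH : measurable_fun setT H.
  by apply: measurable_Phi_comp => //; exact: measurable_funeM.
pose X := coord_space R N; pose mR := measurableTypeR R.
pose W (z : X * mR) : \bar R := heat z.2 H z.1.
pose r (s : R) := Num.sqrt T / Num.sqrt s.
have LE s : logscale T s = ln (expR 1 + r s) by [].
have W0 z : QT T z -> (0 <= W z)%E.
  by move=> [zO /andP[z0 _]]; exact: heat_ge0.
have r1 s : 0 < s -> s < T -> 1 <= r s.
  move=> s0 sT; rewrite ler_pdivlMr ?sqrtr_gt0// mul1r; apply: ler_wsqrtr; exact: ltW.
have r2 s : 0 < s -> r s ^+ 2 = T / s.
  by move=> s0; rewrite expr_div_n !sqr_sqrtr// ltW.
have Wle z : QT T z ->
    (W z <= (eta * r z.2 `^ (2 * k) * logscale T z.2 `^ (b - k))%:E)%E.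
  move=> [zO /andP[z0 zT]].
  pose M := eta / Cs * c * ln (expR 1 + Num.sqrt T / Num.sqrt z.2) `^ (b - k).
  have := hCs H z.2 M z.1 mH H0 z0 zO.
  have -> : Cs * z.2 `^ (- ((N%:R + l) / 2)) * M =
     eta * r z.2 `^ (2 * k) * logscale T z.2 `^ (b - k).
    rewrite powRrM powR_mulrn ?divr_ge0 ?sqrtr_ge0// r2//.
    rewrite powRM ?invr_ge0 ?(ltW hT) ?(ltW z0)// -(powR_inv1 (ltW z0)) -powRrM mulN1r.
    rewrite /M -/k -/c LE /r; field; rewrite gt_eqF//.
  apply=> y yO; apply: (@le_integral_BOmega R N l b c _ M f g) => //.
  apply: hf; rewrite sqrtr_gt0 z0/= ltr_sqrt//.
have Wv z : QT T z -> exists v : R, [/\ 0 <= v, Phi_inv b (W z) = v%:E,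
    W z = (v * ln (expR 1 + v) `^ b)%:E,
    v `^ p <= C0 * d `^ (k^-1 / 2) *
      (T / z.2 / (logscale T z.2 * logscale T z.2 `^ b)) *
      (v * ln (expR 1 + v) `^ b) &
    v * ln (expR 1 + v) `^ b <= C0 * logscale T z.2 `^ b * v].
  move=> zQ; have [zO /andP[z0 zT]] := zQ.
  have Wf : W z \is a fin_num.
    by rewrite ge0_fin_numE ?W0//; apply: le_lt_trans (Wle z zQ) _; rewrite ltry.
  have w0 : 0 <= fine (W z) by rewrite fine_ge0// W0.
  have [v [v0 vE wE]] := Phi_invE hb w0.
  rewrite fineK// in vE.
  have WE : W z = (v * ln (expR 1 + v) `^ b)%:E by rewrite -wE fineK.
  exists v; split => //.
    have [] := heta (r z.2) v (r1 _ z0 zT) v0.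
      by have := Wle z zQ; rewrite WE lee_fin.
    by rewrite -kip r2.
  have [] := heta (r z.2) v (r1 _ z0 zT) v0; last by [].
  by have := Wle z zQ; rewrite WE lee_fin.
(* The constant 4 is shared equally between the linear and the Duhamel terms. *)
pose B (z : X * mR) : \bar R := ((4 / c)%:E * Phi_inv b (W z))%E.
have c40 : 0 < 4 / c by rewrite divr_gt0.
have hB : forall w : X * mR -> \bar R, measurable_fun setT w ->
  (forall z, 0 <= w z)%E -> (forall z, QT T z -> w z <= B z)%E ->
  forall z, QT T z -> (heat z.2 g z.1 + duhamel (fun q => w q `^ p) z <= B z)%E.
  move=> w mw w0 wB z zQ; have [zO /andP[z0 zT]] := zQ.
  have [v [v0 vE WE _ wv]] := Wv z zQ.
  have lin : (heat z.2 g z.1 <= (2 / c * v)%:E)%E.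
    exact: (@heat_le_of_heat_Phi R N hN b c v z.2 g z.1).
  have nonlin : (duhamel (fun q => w q `^ p) z <= (2 / c * v)%:E)%E.
    pose ph s := T / s / (logscale T s * logscale T s `^ b).
    pose ka := (4 / c) `^ p * (C0 * d `^ (k^-1 / 2)).
    have ka0 : 0 <= ka by rewrite !mulr_ge0 ?powR_ge0// ltW.
    pose wz := v * ln (expR 1 + v) `^ b.
    have wz0 : 0 <= wz by rewrite mulr_ge0// powR_ge0.
    have L0 s : 0 < logscale T s by rewrite ln_expR1D_gt0// divr_ge0 ?sqrtr_ge0.
    have ph0 s : 0 < s -> 0 <= ph s.
      by move=> s0; rewrite !divr_ge0 ?mulr_ge0 ?powR_ge0 ?ltW.
    have mph : measurable_fun setT ph.
      apply: measurable_funM.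
        by apply: measurable_funM => //; exact: measurable_invr.
      apply: (measurableT_comp measurable_invr).
      apply: measurable_funM; first exact: measurable_logscale.
      by apply: (measurableT_comp (measurable_powR _)); exact: measurable_logscale.
    have mwp : measurable_fun setT (fun q => w q `^ p)%E.
      by apply: (measurableT_comp (measurable_poweR p)).
    have wp0 q : (0 <= w q `^ p)%E by exact: poweR_ge0.
    have wp q : QT T q -> (w q `^ p <= (ka * ph q.2)%:E * heat q.2 H q.1)%E.
      move=> qQ; have [v1 [v10 v1E W1E v1p _]] := Wv _ qQ.
      have := wB _ qQ; rewrite /B v1E -EFinM => wle.
      apply: (@le_trans _ _ ((4 / c * v1)%:E `^ p)%E).
        apply: gt0_ler_poweR; rewrite ?in_itv/= ?leey ?andbT//; first exact: ltW.
        by rewrite lee_fin mulr_ge0// ltW.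
      rewrite -/(W q) poweR_EFin W1E -EFinM lee_fin powRM ?(ltW c40)//.
      rewrite /ka -!mulrA; apply: ler_wpM2l; first exact: powR_ge0.
      by move: v1p; rewrite -!mulrA.
    have mkph : measurable_fun setT (fun s => ka * ph s) by exact: measurable_funM.
    have kph0 s : 0 < s -> 0 <= ka * ph s by move=> s0; rewrite mulr_ge0// ph0.
    apply: le_trans (duhamel_le_heat hN mwp wp0 mH H0 mkph kph0 zQ wp) _.
    rewrite -/(W z) WE -/wz.
    under eq_integral do rewrite (EFinM ka).
    rewrite ge0_integralZl_EFin//; last 2 first.
    - by move=> s /=; rewrite in_itv/= => /andP[s0 _]; rewrite lee_fin ph0.
    - by apply/measurable_EFinP; exact: measurable_funTS.
    rewrite muleCA muleA -(EFinM ka).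
    have ka_wz0 : (0 <= (ka * wz)%:E)%E by rewrite lee_fin mulr_ge0.
    apply: le_trans (lee_wpmul2l ka_wz0 (hCi z.2 z0 zT)) _.
    rewrite -EFinM lee_fin.
    have Lb0 : 0 < logscale T z.2 `^ b by rewrite powR_gt0.
    have bound : ka * wz * (Ci * T / logscale T z.2 `^ b) <= ka * Ci * T * (C0 * v).
      have -> : ka * wz * (Ci * T / logscale T z.2 `^ b) =
        ka * Ci * T * (wz / logscale T z.2 `^ b) by ring.
      apply: ler_wpM2l; first by rewrite (mulr_ge0 (mulr_ge0 ka0 (ltW Ci0)) (ltW hT)).
      by rewrite ler_pdivrMr// mulrAC.
    apply: (le_trans bound).
    (* The powers of T balance because c^(p - 1) = T. *)
    have cp : c `^ p = c * T.
      rewrite kip powRD; last by apply/implyP => _; rewrite gt_eqF.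
      by rewrite powRr1 ?(ltW c0)// /c -(powRrM T k) divff ?gt_eqF// powRr1// ltW.
    have -> : ka * Ci * T * (C0 * v) = A * d `^ (k^-1 / 2) / c * v.
      rewrite /ka /A powRM ?invr_ge0 ?(ltW c0)//.
      have -> : c^-1 `^ p = (c `^ p)^-1.
        by rewrite -(powR_inv1 (ltW c0)) -powRrM mulN1r powRN.
      rewrite cp; field.
      by rewrite !gt_eqF.
    apply: ler_wpM2r => //; apply: ler_wpM2r => //.
    by rewrite invr_ge0 ltW.
  rewrite /B vE -EFinM; apply: le_trans (leeD lin nonlin) _.
  by rewrite -EFinD lee_fin le_eqVlt; apply/orP; left; apply/eqP; field; rewrite gt_eqF.
have [u [mu u0 uB uE]] : exists u : X * mR -> \bar R,
  [/\ measurable_fun (QT T) u, (forall z, QT T z -> 0 <= u z)%E,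
      (forall z, QT T z -> u z <= B z)%E &
      (forall z, QT T z -> u z = heat z.2 g z.1 + duhamel (fun q => u q `^ p) z)%E].
  apply: supersolution_iteration => //.
  - exact: measurable_heat.
  - by move=> z [zO /andP[z0 _]]; exact: heat_ge0.
  - move=> z /Wv[v [v0 vE _ _ _]]; rewrite /B vE -EFinM lee_fin mulr_ge0//; exact: ltW.
  - by move=> z /Wv[v [v0 vE _ _ _]]; rewrite /B vE -EFinM ltry.
have Boo z : QT T z -> (B z < +oo)%E.
  by move=> /Wv[v [v0 vE _ _ _]]; rewrite /B vE -EFinM ltry.
exists u; split.
  split; first split => //.
  - by exists u => //; exact: ae_eq_refl.
  - by apply: aeW => z zQ; exact: le_lt_trans (uB z zQ) (Boo z zQ).
  - apply: aeW => z zQ; have [zO /andP[z0 _]] := zQ.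
    rewrite /= uE//; congr (_ + _)%E.
    by rewrite (xN_density_integral_K fL mg g0 gO fg).
exists (4 / c) => //; apply: aeW => z zQ; split; first exact: u0.
apply: (le_trans (uB z zQ)); rewrite /B le_eqVlt; apply/orP; left; apply/eqP.
congr (_ * Phi_inv b _)%E; apply: integral_ae_eq_class.
(* W was built from the representative g of f. *)
apply: filterS fg => y fgy yO.
by rewrite /H fgy.
Qed.
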